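(* Let $\Gamma$ be a finite flag complex. Then $\Gamma$ is an obstruction to shellability if and only if $\Gamma$ is an obstruction to partitionability, if and only if $\Gamma$ is an obstruction to sequential Cohen-Macaulayness. That is, in the class of flag complexes the three sets of obstructions coincide.
   Context: A simplicial complex $\Gamma$ is a family of subsets (faces) of a finite set closed under taking subsets; $\dim\sigma=|\sigma|-1$, facets are inclusion-maximal faces, $V(\Gamma)$ is the set of vertices. $\Gamma$ is a flag complex if all its minimal non-faces (inclusion-minimal subsets of $V(\Gamma)$ not in $\Gamma$) have size $2$. For $W\subseteq V(\Gamma)$, $\Gamma[W]$ is the subcomplex of faces contained in $W$. $\mathrm{link}_\Gamma(\tau)=\{\eta\in\Gamma:\eta\cap\tau=\emptyset,\ \eta\cup\tau\in\Gamma\}$; $\mathrm{pure}_i(\Gamma)$ is the set of subfaces of $i$-dimensional faces. A sequence of all facets $\sigma_1,\dots,\sigma_t$ is a shelling if for each $j\ge2$, $(\bigcup_{i<j}\overline{\sigma_i})\cap\overline{\sigma_j}$ is pure of dimension $\dim\sigma_j-1$ ($\overline\sigma$ = all subsets of $\sigma$; facets may have different dimensions); $\Gamma$ is shellable if it has a shelling. $\Gamma$ is partitionable if it is a disjoint union of intervals $[\tau_\sigma,\sigma]=\{\eta:\tau_\sigma\subseteq\eta\subseteq\sigma\}$, one per facet $\sigma$. A pure complex is Cohen-Macaulay (over $\mathbb Z$) if $\widetilde H_k(\mathrm{link}_\Gamma(\tau);\mathbb Z)=0$ for all $\tau\in\Gamma$ and $k\neq\dim\mathrm{link}_\Gamma(\tau)$;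 $\Gamma$ is sequentially Cohen-Macaulay if every $\mathrm{pure}_i(\Gamma)$ is Cohen-Macaulay. $\Gamma$ is an obstruction to a property $\mathcal P$ if $\Gamma$ fails $\mathcal P$ but $\Gamma[W]$ satisfies $\mathcal P$ for all $W\subsetneq V(\Gamma)$. *)

(* Defs.v *)
From HB Require Import structures.
From mathcomp Require Import all_boot all_order all_algebra.

Set Implicit Arguments.
Unset Strict Implicit.
Unset Printing Implicit Defensive.

Import GRing.Theory.
Local Open Scope ring_scope.

(* A complex is a family of subsets of an ambient finite type [V].  An element
   of [V] need not be a vertex of the complex: [vertices G] is the set V(G). *)
Section Complexes.
Variable V : finType.
Implicit Types (G K : {set {set V}}) (s t : {set V}) (W : {set V}).

Definition simplicial_complex G : Prop :=
  forall s t, s \in G -> t \subset s -> t \in G.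

Definition vertices G : {set V} := [set v | [set v] \in G].

Definition fdim s : int := #|s|%:Z - 1.

(* The empty family gets dimension -1, like [set set0]; this value is never
   relevant below. *)
Definition dim G : int := (\max_(s in G) #|s|)%N%:Z - 1.

Definition facets G : {set {set V}} := [set s | maxset (fun t => t \in G) s].

Definition minimal_nonface G s : bool :=
  minset (fun t => (t \subset vertices G) && (t \notin G)) s.

(* The empty family is not flag, since set0 is then a minimal non-face. *)
Definition flag G : Prop := forall s, minimal_nonface G s -> #|s| = 2%N.

Definition restrict G W : {set {set V}} := [set s in G | s \subset W].

Definition link G t : {set {set V}} :=
  [set s in G | [disjoint s & t] && (s :|: t \in G)].

Definition pure_part (i : int) G : {set {set V}} :=
  [set t : {set V} | [exists s in G, (fdim s == i) && (t \subset s)]].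

Definition pure G : Prop := forall s, s \in facets G -> fdim s = dim G.

Definition pure_of_dim G (d : int) : Prop := pure G /\ dim G = d.

(* Positions in the sequence [F] are numbered from 0. *)
Definition shelling G (F : seq {set V}) : Prop :=
  [/\ uniq F, F =i facets G &
      forall j, (0 < j < size F)%N ->
        pure_of_dim
          ((\bigcup_(i < j) powerset (nth set0 F i)) :&: powerset (nth set0 F j))
          (fdim (nth set0 F j) - 1)].

Definition shellable G : Prop := exists F : seq {set V}, shelling G F.

Definition interval t s : {set {set V}} :=
  [set u : {set V} | (t \subset u) && (u \subset s)].

Definition partitionable G : Prop :=
  exists tau : {set V} -> {set V},
    [/\ forall s, s \in facets G -> tau s \subset s,
        G = \bigcup_(s in facets G) interval (tau s) s &
        forall s s', s \in facets G -> s' \in facets G -> s != s' ->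
          [disjoint interval (tau s) s & interval (tau s') s']].

(* Augmented simplicial chains with integer coefficients: a k-chain of K is an
   integer function on subsets of V supported on the k-dimensional faces of K.
   The empty face spans the chains of degree -1.  Faces are oriented by the
   order [enum_rank] on V. *)
Definition chain K (k : int) (c : {ffun {set V} -> int}) : Prop :=
  forall s, c s != 0 -> s \in K /\ fdim s = k.

(* If v_0 < ... < v_k are the elements of s, the boundary of s is the sum of
   the (-1)^j (s \ v_j); hence the coefficient of the boundary of c at t
   collects the terms c (v |: t) for v outside t, and the exponent is the
   position of v in v |: t. *)
Definition boundary (c : {ffun {set V} -> int}) : {ffun {set V} -> int} :=
  [ffun t : {set V} => \sum_(v | v \notin t)
     (-1) ^+ #|[set w in t | (enum_rank w < enum_rank v)%N]| * c (v |: t)].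

(* The k-th reduced homology group ker / im is zero. *)
Definition reduced_homology_vanishes K (k : int) : Prop :=
  forall z, chain K k z -> boundary z = 0 ->
    exists2 b, chain K (k + 1) b & boundary b = z.

Definition cohen_macaulay G : Prop :=
  pure G /\
  forall t (k : int), t \in G -> k <> dim (link G t) ->
    reduced_homology_vanishes (link G t) k.

Definition sequentially_cohen_macaulay G : Prop :=
  forall i : int, cohen_macaulay (pure_part i G).

Definition obstruction (P : {set {set V}} -> Prop) G : Prop :=
  ~ P G /\ forall W, W \proper vertices G -> P (restrict G W).

End Complexes.

(* Main.v *)
(** Let e be the graph of the non-edges of the flag complex G, so that the faces
of G[W] are the independent sets of e in W.  Call an induced cycle of e bad if
its length is 4 or at least 6.  For each of the three properties P, the
obstructions to P are the complexes whose vertex set contains a bad cycle while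
no proper subset does; this follows from two facts.

- (Woodroofe) If W contains no bad cycle then the independence complex of e[W]
  is vertex decomposable, hence shellable, partitionable and sequentially
  Cohen-Macaulay.  If e[W] contains an induced path on three vertices, it
  contains one that does not extend at both ends to an induced path on five
  vertices (otherwise a bad cycle appears), and the middle vertex of such a
  path is a shedding vertex.  If it contains none, e[W] is a disjoint union of
  cliques and an endpoint of any edge is a shedding vertex.

- The independence complex of a bad cycle of length N has none of the three
  properties.  Its faces of maximal size N./2 are the N alternating sets F p.
  For N even there are only two of them, and they are disjoint.  For N odd
  they form a strip closing up around a circle: counting the one-element faces
  excludes a partition, and the winding number gives a nonzero first homology
  class of the pure part of top dimension. *)

From HB Require Import structures.
From mathcomp Require Import all_boot all_order all_algebra.
From mathcomp Require Import zify ring.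
Require Import Defs.
Set Implicit Arguments.
Unset Strict Implicit.
Unset Printing Implicit Defensive.
Import GRing.Theory.

(** * Chordless cycles and shedding vertices *)

Section Graph.
Variables (V : finType) (e : rel V).
Hypotheses (e_sym : symmetric e) (e_irr : irreflexive e).
Implicit Types (x y a b c v w : V) (s W U : {set V}) (p : seq V).

Definition indep W : {set {set V}} :=
  [set s : {set V} | (s \subset W) && [forall x in s, forall y in s, ~~ e x y]].

Lemma indepP W s :
  reflect (s \subset W /\ {in s &, forall x y, ~~ e x y}) (s \in indep W).
Proof.
rewrite inE; apply: (iffP andP) => -[sW H]; split=> //.
  by move=> x y xs ys; move/forall_inP/(_ x xs)/forall_inP/(_ y ys): H.
by apply/forall_inP=> x xs; apply/forall_inP=> y ys; apply: H.
Qed.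

(** The vertices of an induced path, listed in order. *)
Fixpoint chordless p : bool :=
  if p is x :: q then
    [&& x \notin q, (if q is y :: r then e x y && all (fun z => ~~ e x z) r else true) & chordless q]
  else true.

Lemma chordless_suffix x p : chordless p -> x \in p ->
  exists q, [/\ chordless (x :: q), last x q = last x p & {subset q <= p}].
Proof.
elim: p => //= y p IH /and3P[yp hp cp]; rewrite inE.
have [xp _|xp /orP[/eqP exy|//]] := boolP (x \in p).
  have [q [cq lq sq]] := IH cp xp; exists q; split=> //.
    by rewrite lq; case: (p) xp.
  by move=> z /sq zp; rewrite inE zp orbT.
subst y; exists p; split=> //; first by rewrite /= yp hp.
by move=> z zp; rewrite inE zp orbT.
Qed.

(** The part of p from the last neighbour of x onwards is kept. *)
Lemma chordless_cons x p : chordless p -> x \notin p -> has (e x) p ->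
  exists q, [/\ chordless (x :: q), last x q = last x p & {subset q <= p}].
Proof.
elim: p => //= y p IH /and3P[yp hp cp]; rewrite inE negb_or => /andP[xy xp].
have [hxp _|hxp] := boolP (has (e x) p).
  have [q [cq lq sq]] := IH cp xp hxp; exists q; split=> //.
    by rewrite lq; case: (p) hxp.
  by move=> z /sq zp; rewrite inE zp orbT.
rewrite orbF => exy; exists (y :: p); split=> //=.
by rewrite inE negb_or xy xp exy yp hp cp !andbT /= all_predC.
Qed.

(** The induced path is built from the far end: a new vertex either lies on it already, and the path
    is cut there, or is attached at its last neighbour. *)
Lemma chordless_of_path x p : path e x p ->
  exists q, [/\ chordless (x :: q), last x q = last x p & {subset q <= p}].
Proof.
elim: p x => [|y p IH] x /=; first by exists [::].
case/andP=> exy /IH[q [cq lq sq]].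
have sub r : {subset r <= y :: q} -> {subset r <= y :: p}.
  by move=> h z /h; rewrite !inE => /orP[->//|/sq ->]; rewrite orbT.
have [xq|xq] := boolP (x \in y :: q).
  have [r [cr lr sr]] := chordless_suffix cq xq.
  by exists r; split; [|rewrite lr /= lq|apply: sub].
have [|r [cr lr sr]] := chordless_cons cq xq; first by rewrite /= exy.
by exists r; split; [|rewrite lr /= lq|apply: sub].
Qed.

Lemma chordless_uniq p : chordless p -> uniq p.
Proof. by elim: p => //= x p IH /and3P[-> _ /IH]. Qed.

Lemma chordless_nth x0 p i j : chordless p -> i < j < size p ->
  e (nth x0 p i) (nth x0 p j) = (j == i.+1).
Proof.
elim: p i j => [|x p IH] i j; first by rewrite ltn0 andbF.
case: j => [//|j] /= /and3P[xp hp cp] /andP[ij jp].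
case: i ij => [_|i ij] /=; last by rewrite IH // -ltnS ij.
case: p xp hp cp jp {IH} => [//|y p] /= _ /andP[exy /allP ne] _.
case: j => [|j] //= jp; rewrite eqSS /=; apply/negbTE/ne/mem_nth.
by rewrite -ltnS.
Qed.

(* The length is [n + 4], so that [n <> 1] excludes length 5. *)
Definition bad_cycle W : Prop :=
  exists n (f : 'I_n.+4 -> V),
    [/\ n <> 1, injective f, W = f @: setT &
        forall i j, e (f i) (f j) = (j == i + 1)%R || (i == j + 1)%R].

Definition good W : Prop := forall C : {set V}, C \subset W -> ~ bad_cycle C.

Lemma val_succ n (i : 'I_n.+2) : val (i + 1)%R = if i == ord_max then 0 else i.+1.
Proof.
rewrite -val_eqE /= (modn_small (_ : 1 < n.+2)) // addn1; have := ltn_ord i.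
by case: (nat_of_ord i =P n.+1) => [->|ne hi]; rewrite ?modnn // modn_small //; lia.
Qed.

(** The vertex a closes an induced path by being adjacent to exactly its two ends. *)
Lemma cycle_of_path a p n :
  chordless p -> size p = n.+3 -> a \notin p ->
  (forall i, i < n.+3 -> e a (nth a p i) = (i == 0) || (i == n.+2)) ->
  n <> 1 -> bad_cycle [set x in a :: p].
Proof.
move=> cp sp ap ha n1.
have up : uniq (a :: p) by rewrite /= ap chordless_uniq.
exists n, (fun i => nth a (a :: p) i); split=> //.
- move=> i j /eqP; rewrite nth_uniq /= ?sp // => /eqP; exact: val_inj.
- apply/setP=> x; rewrite inE; apply/idP/imsetP => [xp|[i _ ->]].
    have ix : index x (a :: p) < n.+4 
    by move: xp; rewrite -index_mem [size _]/= sp.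
    by exists (Ordinal ix) => //; apply/esym/nth_index.
  by apply: mem_nth; rewrite /= sp.
pose P (i j : 'I_n.+4) := (j == i + 1)%R || (i == j + 1)%R.
have PS i j : P i j = P j i by rewrite /P orbC.
have main (i j : 'I_n.+4) : (i < j)%N -> e (nth a (a :: p) i) (nth a (a :: p) j) = P i j.
  rewrite /P -![_ == (_ + 1)%R]val_eqE !val_succ -!val_eqE /=.
  case: i j => [[|i] hi] [[|j] hj] //= ij.
    rewrite ha //; case: ifP; lia.
  rewrite (chordless_nth _ cp) ?sp; last by lia.
  by do 2!case: ifP; lia.
move=> i j; have [ij|ji|/val_inj->] := ltngtP i j.
- exact: main.
- by rewrite e_sym main // PS.
by rewrite e_irr; apply/esym; rewrite -val_eqE val_succ; case: ifP => [/eqP->|] //=; lia.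
Qed.

(** Otherwise a b c d would be an induced cycle of length 4. *)
Lemma four_cycle W a b c d : good W ->
  [/\ a \in W, b \in W, c \in W & d \in W] ->
  [&& e a b, e b c, e c d & e d a] -> a != c -> ~~ e a c -> b != d -> e b d.
Proof.
move=> gW [aW bW cW dW] /and4P[ab bc cd da] ac eac bd; apply: contraT => ebd.
suff : bad_cycle [set x in [:: a; b; c; d]].
  case/(gW _ _); apply/subsetP=> x; rewrite !inE => /or4P[]/eqP-> //.
have ne x y : e x y -> x != y by apply: contraTneq => ->; rewrite e_irr.
apply: (@cycle_of_path a [:: b; c; d] 0) => //=.
- by rewrite !inE bc cd ebd !negb_or bd (ne _ _ bc) (ne _ _ cd).
- by rewrite !inE !negb_or (ne _ _ ab) ac eq_sym (ne _ _ da).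
by move=> [|[|[|i]]] //= _; [rewrite (negbTE eac)|rewrite e_sym].
Qed.

Definition p3 a b c := [&& e a b, e b c, a != c & ~~ e a c].

(** An induced path on five vertices: for [e] symmetric and irreflexive the adjacency pattern forces
    them to be distinct. *)
Definition p5 x a b c y :=
  [&& e x a, e a b, e b c, e c y, ~~ e x b, ~~ e x c, ~~ e x y, ~~ e a c, ~~ e a y & ~~ e b y].

Lemma p5_rev x a b c y : p5 x a b c y = p5 y c b a x.
Proof.
rewrite /p5 (e_sym y c) (e_sym c b) (e_sym b a) (e_sym a x) (e_sym y b) (e_sym y a).
rewrite (e_sym y x) (e_sym c a) (e_sym c x) (e_sym b x).
by do 10!case: (e _ _).
Qed.

Lemma p5_p3 x a b c y : p5 x a b c y -> p3 b c y.
Proof.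
case/and5P=> _ ab bc cy /and5P[_ _ _ _ /andP[nay nby]]; rewrite /p3 bc cy nby andbT /=.
by apply: contraNneq nay => <-.
Qed.

(** * Connected sets and the vertices away from them *)

Definition connected U : bool :=
  [forall x in U, forall y in U, connect (fun a b => [&& e a b, a \in U & b \in U]) x y].

Lemma connectedU1 U v u : connected U -> u \in U -> e u v -> connected (v |: U).
Proof.
move=> /forall_inP cU uU euv.
set e' := fun a b => [&& e a b, a \in v |: U & b \in v |: U].
have e'_sym : symmetric e' by move=> x y; rewrite /e' e_sym [X in _ && X]andbC.
have toU x : x \in v |: U -> connect e' x u.
  case/setU1P=> [->|xU].
    by apply: connect1; rewrite /e' e_sym euv !inE eqxx uU orbT.
  have /forall_inP/(_ _ uU) := cU _ xU.
  apply: connect_sub => y z /and3P[eyz yU zU].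
  by apply: connect1; rewrite /e' eyz !inE yU zU !orbT.
apply/forall_inP=> x xU; apply/forall_inP=> y yU.
apply: connect_trans (toU _ xU) _.
by rewrite (sym_connect_sym e'_sym) toU.
Qed.

Lemma connected1 u : connected [set u].
Proof.
by apply/forall_inP=> x /set1P->; apply/forall_inP=> y /set1P->; apply: connect0.
Qed.

Definition away W U : {set V} := [set x in W | (x \notin U) && [forall u in U, ~~ e u x]].

Lemma awayP W U x :
  reflect [/\ x \in W, x \notin U & forall u, u \in U -> ~~ e u x] (x \in away W U).
Proof. by rewrite inE; apply: (iffP and3P) => -[-> -> /forall_inP]. Qed.

Definition has_p3 W : bool := [exists a in W, exists b in W, exists c in W, p3 a b c].

Lemma has_p3I W a b c : a \in W -> b \in W -> c \in W -> p3 a b c -> has_p3 W.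
Proof.
move=> aW bW cW h; apply/exists_inP; exists a => //; apply/exists_inP; exists b => //.
by apply/exists_inP; exists c.
Qed.

(* Joining the two ends of the path x a b c y through U would yield a chordless
   cycle of length at least 6. *)
Lemma p5_through_connected W U x a b c y :
  good W -> U \subset W -> connected U -> p5 x a b c y ->
  [/\ a \in away W U, b \in away W U & c \in away W U] ->
  x \in W -> y \in W -> x \notin U -> y \notin U ->
  ~~ (x \in away W U) -> ~~ (y \in away W U) -> False.
Proof.
move=> gW UW cU p5x [/awayP[aW aU aUe] /awayP[bW bU bUe] /awayP[cW cU' cUe]] xW yW xU yU.
have near z : z \in W -> z \notin U -> ~~ (z \in away W U) -> exists2 u, u \in U & e u z.
  move=> zW zU; rewrite inE zW zU /= negb_forall => /existsP[u].
  by rewrite negb_imply negbK => /andP[]; exists u.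
move=> xR yR; have [u uU eux] := near _ xW xU xR; have [w wU ewy] := near _ yW yU yR.
have /forall_inP/(_ _ wU)/forall_inP/(_ _ uU)/connectP[p pp lp] := cU.
have pU : {subset w :: p <= U}.
  elim: p w wU pp {lp ewy} => [|z p IH] w wU /=; first by move=> _ t; rewrite inE => /eqP->.
  by case/andP=> /and3P[_ _ zU] /(IH z zU) sp t; rewrite inE => /orP[/eqP->//|/sp].
(* The walk from y to x has all its inner vertices in [U]; it is then shortened to an induced
   path. *)
have ep : path e y (w :: rcons p x).
  rewrite /= e_sym ewy rcons_path -lp eux andbT.
  by apply: sub_path pp => s t /andP[].
have [q [cq]] := chordless_of_path ep; rewrite /= last_rcons => lq sq.
have qUx z : z \in q -> z \in U \/ z = x.
  move/sq; rewrite inE mem_rcons inE orbCA => /orP[/eqP->|zp]; [by right|left].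
  by apply: pU; rewrite inE.
case/and5P: (p5x) => exa eab ebc ecy /and5P[nxb nxc nxy nac /andP[nay nby]].
have neR t : t \in q -> t \notin away W U.
  move=> /qUx[tU|-> //]; by rewrite inE tU !andbF.
have nea t (tR : t \in away W U) : t \notin q by apply: contraL tR => /neR.
have adj t r : t \in q -> r \in away W U -> e x r = false -> e r t = false.
  move=> /qUx[tU /awayP[_ _ h] _|-> _]; last by rewrite e_sym.
  by rewrite e_sym; apply/negbTE/h.
have [aR bR cR] : [/\ a \in away W U, b \in away W U & c \in away W U].
  by split; apply/awayP.
have neq r : r \in away W U -> r != y by apply: contraTneq => ->.
case: q lq cq qUx {sq} neR nea adj => [|z q] lq cq qUx neR nea adj.
  by move: nay; rewrite -[y]/(last y [::]) lq e_sym exa.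
(* Since x and y are not adjacent, the induced path from y to x has an inner vertex, so the cycle
   closed by a, b, c has length at least 6. *)
have q0 : 0 < size q.
  case: q lq cq {qUx neR nea adj} => //= zx; rewrite zx e_sym (negbTE nxy) andbF //.
suff : bad_cycle [set v in a :: b :: c :: y :: z :: q].
  apply: gW; apply/subsetP=> t; rewrite inE 4!inE.
  case/or4P=> [/eqP->|/eqP->|/eqP->|/orP[/eqP->|tq]] //.
  by case: (qUx t tq) => [/(subsetP UW)|->].
have cne t : t \in z :: q -> e c t = false by move=> tq; apply: adj => //; apply/negbTE.
have bne t : t \in z :: q -> e b t = false by move=> tq; apply: adj => //; apply/negbTE.
have e_ne r t : e r t -> r != t by apply: contraTneq => ->; rewrite e_irr.
have anec : a != c by apply: contraTneq exa => ->.
apply: (@cycle_of_path a (b :: c :: y :: z :: q) (size q).+1) => //.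
- have cc : chordless (c :: y :: z :: q).
    rewrite [chordless _]/= -/(chordless (y :: z :: q)) cq inE negb_or neq //= nea // ecy /=.
    rewrite andbT -/(all (fun t => ~~ e c t) (z :: q)); apply/allP=> t /cne->; done.
  have bp : b \notin [:: c, y, z & q].
    by rewrite in_cons negb_or (e_ne _ _ ebc) in_cons negb_or (neq _ bR) nea.
  apply/and3P; split=> //; apply/andP; split=> //.
  by apply/allP=> t; rewrite in_cons => /orP[/eqP->|/bne->].
- by rewrite in_cons negb_or (e_ne _ _ eab) in_cons negb_or anec in_cons negb_or (neq _ aR) nea.
- move=> [|[|[|i]]]; rewrite [nth _ _ _]/= ?eab ?(negbTE nac) ?(negbTE nay) //.
  rewrite -[nth _ _ _]/(nth a (z :: q) i) !eqSS => hi.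
  have hi' : i < size (z :: q) by [].
  have xE : nth a (z :: q) (size q) = x by rewrite -lq (nth_last a (z :: q)).
  have uq : uniq (z :: q) by have /= /andP[] := chordless_uniq cq.
  have [->|ne] := eqVneq i (size q); first by rewrite xE e_sym exa.
  have tq : nth a (z :: q) i \in z :: q by apply: mem_nth.
  rewrite e_sym; case: (qUx _ tq) => [tU|/eqP]; first exact/negbTE/aUe.
  by rewrite -xE nth_uniq //= (negbTE ne).
by case: (size q) q0.
Qed.

(* Choose U connected and maximal such that a p3 remains away from it.  By
   maximality, and by p5_through_connected, a p3 that is unextendable away from
   U is unextendable in W, so induction applies. *)
Lemma unextendable_p3 W : good W -> has_p3 W ->
  exists a b c, [/\ a \in W, b \in W, c \in W & p3 a b c] /\
    forall x y, x \in W -> y \in W -> ~~ p5 x a b c y.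
Proof.
have [k] := ubnP #|W|; elim: k W => // k IH W leWk gW hW.
(* If x and y extend a b c to an induced path on five vertices, then b c y is a [p3] away from x as
   well as from [U]. *)
have p5away U x a b c y : x \in W -> p5 x a b c y ->
    b \in away W U -> c \in away W U -> y \in away W U -> has_p3 (away W (x |: U)).
  move=> xW px bR cR yR.
  have sub z : z \in away W U -> z != x -> ~~ e x z -> z \in away W (x |: U).
    move=> /awayP[zW zU zUe] zx exz; apply/awayP; split=> //.
      by rewrite !inE negb_or zx.
    by move=> u /setU1P[->|/zUe].
  have := p5_p3 px; apply: has_p3I; apply: sub => //;
    case/and5P: px => exa eab ebc ecy /and5P[nxb nxc nxy nac /andP[nay nby]] //.
  - by apply: contraNneq nxc => <-.
  - by apply: contraNneq nxb => <-; rewrite e_sym.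
  - by apply: contraNneq nxc => <-; rewrite e_sym.
(* If no [p3] is away from a single vertex, every [p3] is unextendable: an extension would leave b c
   y away from x. *)
case: (pickP [pred u in W | has_p3 (away W [set u])]) => [u /andP[uW hu]|none]; last first.
  have /existsP[a /andP[aW /existsP[b /andP[bW /existsP[c /andP[cW habc]]]]]] := hW.
  exists a, b, c; split=> // x y xW yW; apply/negP=> px.
  have := none x; rewrite /= xW -[[set x]]setU0 (p5away _ _ _ _ _ _ xW px) //;
    by apply/awayP; split=> //= [|u]; rewrite inE.
have Pu : [&& [set u] \subset W, connected [set u] & has_p3 (away W [set u])].
  by rewrite sub1set uW connected1.
have [U /maxsetP[/and3P[UW cU hU] maxU] uU] :=
  @maxset_exists _ (fun U => [&& U \subset W, connected U & has_p3 (away W U)]) _ Pu.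
rewrite sub1set in uU.
have sW : away W U \subset W by apply/subsetP=> z /awayP[].
have [|||a [b [c [[aR bR cR habc] hsim]]]] := IH (away W U).
- rewrite -ltnS; apply: leq_trans leWk; rewrite ltnS; apply: proper_card.
  apply/properP; split=> //; exists u => //; apply/negP=> /awayP[_]; by rewrite uU.
- by move=> C CW; apply: gW; apply: subset_trans CW sW.
- exact: hU.
exists a, b, c; split; first by split=> //; apply: (subsetP sW).
move=> x y xW yW; apply/negP=> px.
have notU z t : e z t -> t \in away W U -> z \notin U.
  by move=> ezt /awayP[_ _ h]; apply: contraL ezt => /h.
(* If x' were not away from [U], it would have a neighbour in [U], and x' |: U would be a larger
   connected set with a [p3] away from it. *)
have half x' a' b' c' y' : x' \in W -> p5 x' a' b' c' y' -> a' \in away W U ->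
   b' \in away W U -> c' \in away W U -> y' \in away W U -> x' \in away W U.
  move=> xW' px' aR' bR' cR' yR'; apply: contraT => xR.
  have xU : x' \notin U by apply: (notU _ a') => //; case/andP: px'.
  have [v vU evx] : exists2 v, v \in U & e v x'.
    move: xR; rewrite inE xW' xU /= negb_forall => /existsP[v].
    by rewrite negb_imply negbK => /andP[]; exists v.
  have := maxU (x' |: U); rewrite subsetUr => E; move: xU; rewrite -E ?setU11 //.
  rewrite subUset sub1set xW' UW (@connectedU1 U x' v) // 1?e_sym //.
  exact: (p5away _ _ _ _ _ _ xW' px').
have pxr := px; rewrite p5_rev in pxr.
(* If one end is away from [U], so is the other, against the choice of a b c; if neither is,
   [p5_through_connected] applies. *)
have [yR|yR] := boolP (y \in away W U).
  have xR := half _ _ _ _ _ xW px aR bR cR yR.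
  by have := hsim x y xR yR; rewrite px.
have [xR|xR] := boolP (x \in away W U).
  by rewrite (half _ _ _ _ _ yW pxr) in yR.
apply: (p5_through_connected gW UW cU px) xR yR => //.
  by apply: (notU _ a) => //; case/andP: px.
by apply: (notU _ c) => //; case/andP: pxr.
Qed.

(** In the independence complex of [W], no face of the link of v is a facet of the deletion of v. *)
Definition shedding W v :=
  forall s, s \in indep (W :\: (v |: [set x | e v x])) ->
    exists w, [/\ w \notin s, w != v & w |: s \in indep (W :\ v)].

Lemma exists_shedding W u v : good W -> u \in W -> v \in W -> e u v ->
  exists2 w, w \in W & shedding W w.
Proof.
move=> gW uW vW euv.
have [/(unextendable_p3 gW)|np3] := boolP (has_p3 W).
  case=> a [b [c [[aW bW cW /and4P[eab ebc ac nac]] hsim]]]; exists b => // s.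
  case/indepP=> sW si.
  have sP x : x \in s -> [/\ x \in W, x != b & ~~ e b x].
    by move/(subsetP sW); rewrite !inE negb_or -andbA => /and3P[].
  have ext w : w \in W -> e b w -> [forall x in s, ~~ e w x] ->
      exists w, [/\ w \notin s, w != b & w |: s \in indep (W :\ b)].
    move=> wW ebw /forall_inP ws; have wb : w != b by apply: contraTneq ebw => ->; rewrite e_irr.
    exists w; split=> //; first by apply: contraL ebw => /sP[].
    apply/indepP; split.
      apply/subsetP=> x /setU1P[->|/sP[xW xb _]]; by rewrite !inE ?wb ?xb.
    move=> x y /setU1P[->|xs] /setU1P[->|ys]; first by rewrite e_irr.
    + exact: ws.
    + by rewrite e_sym ws.
    + exact: si.
  (* If neither a nor c can be added to s, then s contains neighbours x of a and y of c. The chords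
     x c and a y would create induced 4-cycles, so x a b c y is an induced path on five vertices. *)
  have [/ext|] := boolP [forall x in s, ~~ e a x]; first by apply=> //; rewrite e_sym.
  rewrite negb_forall => /existsP[x]; rewrite negb_imply negbK => /andP[xs eax].
  have [/ext|] := boolP [forall x in s, ~~ e c x]; first by apply.
  rewrite negb_forall => /existsP[y]; rewrite negb_imply negbK => /andP[ys ecy].
  have [xW xb nbx] := sP _ xs; have [yW yb nby] := sP _ ys.
  have nxc : ~~ e x c.
    apply: contra nbx => exc; apply: (@four_cycle W a b c x gW) => //; last by rewrite eq_sym.
    by rewrite eab ebc e_sym exc e_sym eax.
  have nay : ~~ e a y.
    apply: contra nby => eay; apply: (@four_cycle W a b c y gW) => //; last by rewrite eq_sym.
    by rewrite eab ebc ecy e_sym eay.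
  have /negP[] := hsim x y xW yW.
  by rewrite /p5 e_sym eax eab ebc ecy e_sym nbx nxc (si x y) // nac nay nby.
(* Here v can always be added to s: a neighbour x of v in s would make u v x a [p3]. *)
exists u => // s /indepP[sW si].
have sP x : x \in s -> [/\ x \in W, x != u & ~~ e u x].
  by move/(subsetP sW); rewrite !inE negb_or -andbA => /and3P[].
have vs x : x \in s -> ~~ e v x.
  move=> /sP[xW xu nux]; apply: contra np3 => evx; apply: (has_p3I uW vW xW).
  by rewrite /p3 euv evx eq_sym xu nux.
have vu : v != u by apply: contraTneq euv => ->; rewrite e_irr.
exists v; split=> //; first by apply: contraL euv => /sP[].
apply/indepP; split.
  apply/subsetP=> x /setU1P[->|/sP[xW xb _]]; by rewrite !inE ?vu ?xb.
move=> x y /setU1P[->|xs] /setU1P[->|ys]; first by rewrite e_irr.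
+ exact: vs.
+ by rewrite e_sym vs.
+ exact: si.
Qed.

End Graph.

(** * Vertex decomposable complexes *)

Section Decomposable.
Variable V : finType.
Implicit Types (G D L K X Y : {set {set V}}) (A s t u : {set V}) (v w x y : V).

(** Only the faces through the apex; the base [L] is not included. *)
Definition cone v L : {set {set V}} := [set v |: s | s in L].

(** Nonpure vertex decomposability, with [D] the deletion of v and [L] its link; the last premise
    makes v a shedding vertex. *)
Inductive vertex_decomposable : {set {set V}} -> Prop :=
| vd_simplex A : vertex_decomposable (powerset A)
| vd_shed D L v :
    vertex_decomposable D -> vertex_decomposable L -> L \subset D ->
    (forall s, s \in D -> v \notin s) ->
    (forall s, s \in L -> exists2 w, w \notin s & w |: s \in D) ->
    vertex_decomposable (D :|: cone v L).

(** * Faces and facets of the complex with deletion [D] and link [L] *)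

Section Cone.
Variables (D L : {set {set V}}) (v : V).
Hypotheses (vD : forall s, s \in D -> v \notin s) (LD : L \subset D).

Lemma notin_link s : s \in L -> v \notin s. Proof. by move=> sL; apply/vD/(subsetP LD). Qed.

Lemma coneE s : (s \in D :|: cone v L) = if v \in s then s :\ v \in L else s \in D.
Proof.
rewrite inE; have [vs|vs] := boolP (v \in s).
  have -> /= : (s \in D) = false by apply: contraTF vs => /vD.
  apply/imsetP/idP => [[t tL ->]|sL]; first by rewrite setU1K // notin_link.
  by exists (s :\ v) => //; rewrite setD1K.
rewrite orbC; case: imsetP => // -[t _ E]; by rewrite E setU11 in vs.
Qed.

Lemma simplicial_cone : simplicial_complex D -> simplicial_complex L ->
  simplicial_complex (D :|: cone v L).
Proof.
move=> hD hL s t; rewrite !coneE; have [vs sL|vs sD] := boolP (v \in s) => ts; case: ifP => vt.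
- by apply: hL sL _; apply: setSD.
- by apply: (subsetP LD); apply: hL sL _; rewrite subsetD1 ts vt.
- by rewrite (subsetP ts) in vs.
- exact: hD ts.
Qed.

Hypothesis shed : forall s, s \in L -> exists2 w, w \notin s & w |: s \in D.

(** A facet of [D] contained in v |: t, with t in [L], would equal t; but by [shed] no face of [L]
    is maximal in [D]. *)
Lemma facets_cone : facets (D :|: cone v L) = facets D :|: cone v (facets L).
Proof.
apply/setP=> s; rewrite [in RHS]inE !inE.
apply/maxsetP/orP => [[sG maxs]|].
  rewrite coneE in sG; move: sG; case: ifP => vs sG; [right|left].
    apply/imsetP; exists (s :\ v); last by rewrite setD1K.
    rewrite inE; apply/maxsetP; split=> // t tL st; have vt := notin_link tL.
    have := maxs (v |: t); rewrite coneE setU11 setU1K // => <- //.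
    - by rewrite setU1K.
    - by rewrite -(setD1K vs) setUS.
  apply/maxsetP; split=> // t tD; apply: maxs.
  by rewrite inE tD.
case=> [/maxsetP[sD maxs]|/imsetP[t]].
  split=> [|t]; first by rewrite inE sD.
  rewrite coneE; case: ifP => vt tG st; last exact: maxs.
  have st' : s \subset t :\ v by rewrite subsetD1 st vD.
  have E := maxs _ (subsetP LD _ tG) st'.
  have [w wt wD] := shed tG; case/negP: wt.
  by rewrite E -(maxs _ wD) ?setU11 // -E subsetUr.
rewrite inE => /maxsetP[tL maxt] ->; have vt := notin_link tL.
split=> [|u]; first by rewrite coneE setU11 setU1K.
rewrite coneE; case: ifP => vu uG su; last by rewrite (subsetP su) ?setU11 in vu.
by rewrite -(maxt _ uG) ?setD1K // subsetD1 vt andbT (subset_trans _ su) // subsetUr.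
Qed.

End Cone.

Lemma facetP G s : reflect (s \in G /\ forall t, t \in G -> s \subset t -> t = s) (s \in facets G).
Proof. by rewrite inE; apply: maxsetP. Qed.

Lemma facet_above G s : s \in G -> exists2 t, t \in facets G & s \subset t.
Proof.
by move=> sG; have [t tM st] := maxset_exists (P := fun t => t \in G) sG; exists t; rewrite ?inE.
Qed.

Lemma facets_powerset A : facets (powerset A) = [set A].
Proof.
apply/setP=> s; rewrite in_set1; apply/facetP/eqP => [[]|->].
  by rewrite inE => sA /(_ A) <- //; rewrite inE.
by split=> [|t]; rewrite inE // => tA At; apply/eqP; rewrite eqEsubset tA.
Qed.

Lemma dim_eq K (d : nat) s : (forall t, t \in K -> #|t| <= d) -> s \in K -> #|s| = d ->
  dim K = (d%:Z - 1)%R.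
Proof.
move=> le sK sd; rewrite /dim; congr (Posz _ - 1)%R; apply/eqP; rewrite eqn_leq.
by rewrite -{2}sd leq_bigmax_cond // andbT; apply/bigmax_leqP.
Qed.

Lemma disjointI X Y :
  (forall u, u \in X -> u \in Y -> False) -> [disjoint X & Y].
Proof. by move=> XY; apply/pred0P=> u; apply/negP=> /andP[/XY]. Qed.

(** The intervals of [D] partition the faces avoiding v; those of [L], with v added to both ends,
    partition the faces through v. *)
Lemma vd_partitionable G : vertex_decomposable G -> partitionable G.
Proof.
elim=> [A|D L v _ [tD [sD eD dD]] _ [tL [sL eL dL]] LD vD shed].
  exists (fun=> set0); split=> [s _||s s']; rewrite ?facets_powerset ?sub0set //.
    by rewrite big_set1; apply/setP=> s; rewrite !inE sub0set.
  by rewrite !inE => /eqP-> /eqP->; rewrite eqxx.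
have vF s : s \in facets D -> v \notin s by case/facetP=> /vD.
have vFL s : s \in facets L -> v \notin s by case/facetP=> /(subsetP LD)/vD.
have /setP memL := eL; have /setP memD := eD.
pose tau s := if v \in s then v |: tL (s :\ v) else tD s.
have tauD s : s \in facets D -> tau s = tD s by move=> /vF vs; rewrite /tau (negbTE vs).
have tauL s : s \in facets L -> tau (v |: s) = v |: tL s.
  by move=> /vFL vs; rewrite /tau setU11 setU1K.
have intL s u : s \in facets L -> (u \in interval (tau (v |: s)) (v |: s)) =
    (v \in u) && (u :\ v \in interval (tL s) s).
  move=> sF; rewrite tauL // !inE subUset sub1set -andbA; congr (_ && _).
  by rewrite subsetD1 (contra (subsetP (sL _ sF) _)) ?vFL // andbT subDset.
have intD s u : s \in facets D -> u \in interval (tau s) s -> v \notin u.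
  by move=> sF; rewrite inE => /andP[_ us]; apply: contra (vF _ sF); apply: subsetP.
exists tau; rewrite facets_cone //; split.
- move=> s /setUP[sF|/imsetP[t tF ->]]; first by rewrite tauD // sD.
  by rewrite tauL // setUS // sL.
- apply/setP=> u; rewrite coneE //; apply/idP/bigcupP => [|[s]].
    case: ifP => vu; rewrite ?memL ?memD => /bigcupP[s sF us].
      by exists (v |: s); [rewrite inE (imset_f _ sF) orbT|rewrite intL // vu].
    by exists s; [rewrite inE sF|rewrite tauD].
  case/setUP=> [sF us|/imsetP[t tF ->]].
    rewrite (negbTE (intD _ _ sF us)) memD; apply/bigcupP; exists s => //; by rewrite -tauD.
  rewrite intL // => /andP[-> h]; rewrite memL; apply/bigcupP; by exists t.
move=> s s' /setUP[sF|/imsetP[t tF ->]] /setUP[s'F|/imsetP[t' t'F ->]] ne.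
- by rewrite !tauD // dD.
- by apply: disjointI => u us; rewrite intL // (negbTE (intD _ _ sF us)).
- by apply: disjointI => u; rewrite intL // => /andP[vu _] /(intD _ _ s'F)/negP.
have {}ne : t != t' by apply: contraNneq ne => ->.
apply: disjointI => u; rewrite !intL // => /andP[-> h] /= h'.
by have /pred0P/(_ (u :\ v)) := dL _ _ tF t'F ne; rewrite /= h h'.
Qed.

(** The exchange form of the shelling condition: each intersection with an earlier facet lies in a
    ridge that is itself covered by an earlier facet. *)
Definition shelling_step (F : seq {set V}) j := forall i, i < j ->
  exists2 l, l < j & exists2 x, x \in nth set0 F j &
    nth set0 F i :&: nth set0 F j \subset nth set0 F j :\ x /\
    nth set0 F j :\ x \subset nth set0 F l.

Lemma shelling_of_steps G F : uniq F -> F =i facets G ->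
  (forall j, j < size F -> shelling_step F j) -> shelling G F.
Proof.
move=> uF eF step; split=> // j /andP[j0 jF].
set Fj := nth set0 F j; set K := _ :&: _.
have memK s : reflect (exists2 i, i < j & s \subset nth set0 F i :&: Fj) (s \in K).
  rewrite inE; apply: (iffP andP) => [[/bigcupP[i _]]|[i ij]].
    rewrite !inE => si sj; exists i => //; by rewrite subsetI si.
  rewrite subsetI !inE => /andP[si ->]; split=> //.
  by apply/bigcupP; exists (Ordinal ij) => //; rewrite inE.
have exK s : s \in K -> exists2 x, x \in Fj & s \subset Fj :\ x /\ Fj :\ x \in K.
  case/memK=> i ij si; have [l lj [x xF [iF Fl]]] := step j jF i ij.
  exists x => //; split; first exact: subset_trans si iF.
  by apply/memK; exists l => //; rewrite subsetI Fl subD1set.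
have cardD x : x \in Fj -> #|Fj :\ x| = #|Fj|.-1 by move=> xF; rewrite (cardsD1 x Fj) xF.
have dK : dim K = (#|Fj|.-1%:Z - 1)%R.
  (* The empty face lies in [K] because j > 0, so [K] contains a ridge of [Fj], which fixes its
     dimension. *)
  have [|x xF [_ xK]] := exK set0; first by apply/memK; exists 0; rewrite ?sub0set.
  apply: dim_eq xK (cardD _ xF) => t /exK[y yF [ty _]].
  by rewrite -(cardD _ yF) subset_leq_card.
have Fj0 : 0 < #|Fj|.
  have [|x xF _] := exK set0; first by apply/memK; exists 0; rewrite ?sub0set.
  by apply/card_gt0P; exists x.
split; last by rewrite dK /fdim; lia.
move=> s /facetP[/exK[x xF [sx xK]]] /(_ _ xK sx) <-; by rewrite dK /fdim cardD.
Qed.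

(** A shelling of [D] is followed by the sets v |: s, for s along a shelling of [L]. *)
Lemma vd_shellable G : vertex_decomposable G -> shellable G.
Proof.
move=> vdG; suff [F [uF eF step]] : exists F : seq {set V},
    [/\ uniq F, F =i facets G & forall j, j < size F -> shelling_step F j].
  by exists F; apply: shelling_of_steps.
elim: vdG => [A|D L v _ [F [uF eF sF]] _ [H [uH eH sH]] LD vD shed].
  exists [:: A]; split=> // [s|[|j] //]; by rewrite facets_powerset !inE.
have vH s : s \in H -> v \notin s by rewrite eH => /facetP[/(subsetP LD)/vD].
pose vU s := v |: s.
have injH : {in H &, injective vU}.
  by move=> s t /vH vs /vH vt E; rewrite -(setU1K vs) -[v |: s]/(vU s) E setU1K.
have vF s : s \in F -> v \notin s by rewrite eF => /facetP[/vD].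
exists (F ++ map vU H); split.
- rewrite cat_uniq uF map_inj_in_uniq // uH andbT /=.
  apply/hasPn=> _ /mapP[s sH' ->]; apply: contraL isT => /vF; by rewrite setU11.
- move=> s; rewrite facets_cone // mem_cat inE eF; congr (_ || _).
  by apply/mapP/imsetP=> -[t tH ->]; exists t; rewrite // ?eH // -eH.
move=> j; rewrite size_cat size_map => jFH; have [jF|Fj] := ltnP j (size F).
  move=> i ij; have iF := ltn_trans ij jF; have [l lj [x]] := sF _ jF _ ij.
  by exists l => //; rewrite !nth_cat jF iF (ltn_trans lj jF); exists x.
have jH : j - size F < size H by lia.
have nj : nth set0 (F ++ map vU H) j = v |: nth set0 H (j - size F).
  by rewrite nth_cat ltnNge Fj /= (nth_map set0).
have vj : v \notin nth set0 H (j - size F) by apply/vH/mem_nth.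
(* Facet i of [D] avoids v, and the base of facet j, being a face of [D], lies in a facet of [D]
   listed before; so v is the element to remove. *)
move=> i ij; rewrite nj; have [iF|Fi] := ltnP i (size F).
  have : nth set0 H (j - size F) \in D.
    by apply: (subsetP LD); have /facetP[] : nth set0 H (j - size F) \in facets L by rewrite -eH mem_nth.
  case/facet_above=> t; rewrite -eF => tF jt; have ti : index t F < size F by rewrite index_mem.
  exists (index t F); first exact: leq_trans ti Fj.
  exists v; rewrite ?setU11 // setU1K // !nth_cat ti iF nth_index //; split=> //.
  apply/subsetP=> y /setIP[yF /setU1P[yv|//]].
  by move: (vF _ (mem_nth set0 iF)); rewrite -yv yF.
have ij' : i - size F < j - size F by lia.
have [l lj [x xH [iH Hl]]] := sH _ jH _ ij'.
exists (size F + l); first by lia.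
exists x; first by rewrite inE xH orbT.
have xv : x != v by apply: contraNneq vj => <-.
have nthH k : k < j - size F -> nth set0 (map vU H) k = v |: nth set0 H k.
  by move=> kj; rewrite (nth_map set0) // (ltn_trans kj).
have U1D s : (v |: s) :\ x = v |: (s :\ x).
  by apply/setP=> y; rewrite !inE; case: (eqVneq y v) => [->|//]; rewrite eq_sym xv.
rewrite !nth_cat (ltnNge i) Fi /= ltnNge leq_addr /= addKn !nthH // -setUIr U1D.
by split; apply: setUS.
Qed.

End Decomposable.

(** * Homology of cones and of vertex decomposable complexes *)

Section Homology.
Variable V : finType.
Implicit Types (G D L K X Y : {set {set V}}) (A s t : {set V}) (u v w x y : V).
Implicit Types (b c z : {ffun {set V} -> int}).

Local Open Scope ring_scope.

(* The incidence number of (v |: s, s) when v is outside s. *)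
Definition sgn v s : int := (-1) ^+ #|[set w in s | (enum_rank w < enum_rank v)%N]|.

Lemma sgn2 v s : sgn v s * sgn v s = 1.
Proof. by rewrite /sgn -expr2 sqrr_sign. Qed.

Lemma sgnU1 u v s : u \notin s ->
  sgn v (u |: s) = (-1) ^+ (enum_rank u < enum_rank v)%N * sgn v s.
Proof.
move=> us; rewrite /sgn -exprD; congr (_ ^+ _).
rewrite (cardsD1 u [set w in u |: s | _]) !inE eqxx /=; congr (_ + _)%N.
apply: eq_card => w; rewrite !inE; case: (eqVneq w u) => [->|//]; by rewrite (negbTE us).
Qed.

(** The two orders of adding u and v carry opposite signs, which is why a double coboundary
    vanishes. *)
Lemma sgn_swap u v s : u != v -> u \notin s -> v \notin s ->
  sgn u (v |: s) * sgn v s = - (sgn v (u |: s) * sgn u s).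
Proof.
move=> uv us vs; rewrite !sgnU1 //.
have : (enum_rank u < enum_rank v)%N = ~~ (enum_rank v < enum_rank u)%N.
  by rewrite -leqNgt ltn_neqAle (inj_eq val_inj) (inj_eq enum_rank_inj) uv.
by case: (enum_rank v < enum_rank u)%N => /= ->; ring.
Qed.

(** * Boundaries, chains and the cone operator *)

Lemma boundaryE c t : boundary c t = \sum_(v | v \notin t) sgn v t * c (v |: t).
Proof. by rewrite ffunE. Qed.

Lemma boundaryD c b : boundary (c + b) = boundary c + boundary b.
Proof.
apply/ffunP=> t; rewrite [RHS]ffunE !boundaryE -big_split /=.
by apply: eq_bigr => v _; rewrite ffunE mulrDr.
Qed.

Lemma boundary0 : boundary (0 : {ffun {set V} -> int}) = 0.
Proof. by apply/ffunP=> t; rewrite boundaryE big1 ?ffunE // => v _; rewrite ffunE mulr0. Qed.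

Lemma boundaryN c : boundary (- c) = - boundary c.
Proof.
apply/ffunP=> t; rewrite [RHS]ffunE !boundaryE -sumrN.
by apply: eq_bigr => v _; rewrite ffunE mulrN.
Qed.

Lemma chain0 K (k : int) : chain K k 0.
Proof. by move=> s; rewrite ffunE eqxx. Qed.

Lemma chainD K (k : int) c b : chain K k c -> chain K k b -> chain K k (c + b).
Proof.
move=> hc hb s; rewrite ffunE; have [->|/hc//] := eqVneq (c s) 0.
by rewrite add0r => /hb.
Qed.

Lemma chainN K (k : int) c : chain K k c -> chain K k (- c).
Proof. by move=> hc s; rewrite ffunE oppr_eq0 => /hc. Qed.

Lemma chainS K X (k : int) c : K \subset X -> chain K k c -> chain X k c.
Proof. by move=> KX hc s /hc[/(subsetP KX)]. Qed.

(** The join of c with v. Together with [off] and [link_chain] it splits a chain into its parts off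
    v and through v. *)
Definition cone_chain v c : {ffun {set V} -> int} :=
  [ffun s : {set V} => if v \in s then sgn v (s :\ v) * c (s :\ v) else 0].

Definition off v c : {ffun {set V} -> int} :=
  [ffun s : {set V} => if v \in s then 0 else c s].

Definition link_chain v c : {ffun {set V} -> int} :=
  [ffun s : {set V} => if v \in s then 0 else sgn v s * c (v |: s)].

Lemma chain_decomp v c : c = off v c + cone_chain v (link_chain v c).
Proof.
apply/ffunP=> s; rewrite !ffunE setD11; case: ifP => vs; last by rewrite addr0.
by rewrite setD1K // mulrA sgn2 mul1r add0r.
Qed.

(** The homotopy formula of a cone: at faces through v both sides agree term by term by the sign
    rule, and at the others only the term of v survives. *)
Lemma boundary_cone v c : (forall s, v \in s -> c s = 0) ->
  boundary (cone_chain v c) = c - cone_chain v (boundary c).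
Proof.
move=> c0; apply/ffunP=> t; rewrite boundaryE [RHS]ffunE [X in _ + X]ffunE [cone_chain _ _ t]ffunE.
have [vt|vt] := boolP (v \in t).
  rewrite c0 // add0r ffunE mulr_sumr -sumrN.
  rewrite [RHS](bigD1 v) /=; last by rewrite setD11.
  rewrite setD1K // c0 // !mulr0 oppr0 add0r.
  apply: eq_big => [u|u ut].
    rewrite !inE negb_and negbK; case: (eqVneq u v) => [->|_] /=; by rewrite ?vt ?andbT ?andbF.
  have uv : u != v by apply: contraNneq ut => ->.
  rewrite ffunE !inE vt orbT.
  have -> : (u |: t) :\ v = u |: (t :\ v).
    by apply/setP=> y; rewrite !inE; case: (eqVneq y u) => [->|_]; rewrite ?uv // orbF.
  rewrite -/(sgn u (t :\ v)) !mulrA -mulNr; congr (_ * _).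
  rewrite -{1}(setD1K vt) sgnU1 ?setD11 // !sgnU1 ?inE ?negb_and ?ut ?orbT //.
  have : (enum_rank u < enum_rank v)%N = ~~ (enum_rank v < enum_rank u)%N.
    by rewrite -leqNgt ltn_neqAle (inj_eq val_inj) (inj_eq enum_rank_inj) uv.
  by case: (enum_rank v < enum_rank u)%N => /= ->; ring.
rewrite (bigD1 v) //= big1 ?addr0 => [|u /andP[ut uv]].
  by rewrite ffunE setU11 setU1K // mulrA sgn2 mul1r.
by rewrite ffunE !inE eq_sym (negbTE uv) (negbTE vt) mulr0.
Qed.

Lemma cone_chainN v c : cone_chain v (- c) = - cone_chain v c.
Proof. by apply/ffunP=> s; rewrite !ffunE; case: ifP; rewrite ?oppr0 // mulrN. Qed.

(** With y the link part, 0 = boundary (off v z) + y - cone_chain v (boundary y). Evaluation at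
    faces through v gives boundary y = 0, and the rest is the first equation. *)
Lemma boundary_off v z : boundary z = 0 ->
  boundary (off v z) = - link_chain v z /\ boundary (link_chain v z) = 0.
Proof.
set y := link_chain v z; have y0 s : v \in s -> y s = 0 by rewrite ffunE => ->.
move=> z0; have := z0; rewrite {1}(chain_decomp v z) boundaryD boundary_cone // -/y => E.
have bo0 s : v \in s -> boundary (off v z) s = 0.
  move=> vs; rewrite boundaryE big1 // => u _; by rewrite ffunE inE vs orbT mulr0.
have by0 : boundary y = 0.
  apply/ffunP=> s; have [vs|vs] := boolP (v \in s).
    by rewrite boundaryE big1 ?ffunE // => u _; rewrite y0 ?mulr0 // inE vs orbT.
  have /ffunP/(_ (v |: s)) := E.
  rewrite [LHS]ffunE [X in _ + X = _]ffunE [X in _ + (_ + X) = _]ffunE [RHS]ffunE.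
  rewrite bo0 ?setU11 // y0 ?setU11 // !add0r [cone_chain _ _ _]ffunE setU11 setU1K //.
  move/eqP; rewrite oppr_eq0 mulf_eq0 [RHS]ffunE; case/orP => [|/eqP-> //].
  by rewrite /sgn signr_eq0.
split=> //; apply/eqP; rewrite -addr_eq0; apply/eqP.
rewrite -{}E by0; congr (_ + _); apply/ffunP=> s; rewrite !ffunE.
by case: ifP; rewrite ?mulr0 subr0.
Qed.

Lemma fdimU1 v s : v \notin s -> fdim (v |: s) = fdim s + 1.
Proof. by move=> vs; rewrite /fdim cardsU1 vs; lia. Qed.

(** * Homology after attaching to [X] a cone over [L] *)

Section ConeStep.
Variables (X L : {set {set V}}) (v : V).
Hypotheses (vX : forall s, s \in X -> v \notin s) (LX : L \subset X).
Let Y := X :|: cone v L.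

Lemma chain_off k z : chain Y k z -> chain X k (off v z).
Proof.
move=> hz s; rewrite ffunE; case: ifP => [|vs /hz[]]; first by rewrite eqxx.
by rewrite coneE // vs.
Qed.

Lemma chain_link k z : chain Y k z -> chain L (k - 1) (link_chain v z).
Proof.
move=> hz s; rewrite ffunE; case: ifP => vs; first by rewrite eqxx.
rewrite mulf_eq0 negb_or => /andP[_ /hz[]]; rewrite coneE // setU11 setU1K ?vs // => sL.
by rewrite fdimU1 ?vs // => <-; rewrite addrK.
Qed.

Lemma chain_cone k c : chain L k c -> chain Y (k + 1) (cone_chain v c).
Proof.
move=> hc s; rewrite ffunE; case: ifP => vs; last by rewrite eqxx.
rewrite mulf_eq0 negb_or => /andP[_ /hc[]]; rewrite coneE // vs => sL.
by move=> <-; rewrite -(@fdimU1 v) ?setD11 // setD1K.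
Qed.

(* If [y] is the part of the cycle [z] in the link of the apex and
   [y = boundary x], then [off v z + x] is a cycle of [X]. *)
Lemma cone_vanishes k : reduced_homology_vanishes L (k - 1) ->
  reduced_homology_vanishes X k -> reduced_homology_vanishes Y k.
Proof.
move=> hL hX z hz z0; have [zo y0] := boundary_off v z0.
have [x] := hL _ (chain_link hz) y0; rewrite subrK => hx xy.
have [||b hb bE] := hX (off v z + x).
- exact: chainD (chain_off hz) (chainS LX hx).
- by rewrite boundaryD zo xy addNr.
exists (b - cone_chain v x).
  apply: chainD; first by apply: chainS hb; apply: subsetUl.
  exact/chainN/chain_cone.
rewrite boundaryD boundaryN boundary_cone => [|s vs]; last first.
  apply/eqP; apply: contraTT vs => /hx[sL _]; exact/vX/(subsetP LX).
by rewrite bE xy [RHS](chain_decomp v z) opprB addrACA subrr addr0.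
Qed.

End ConeStep.

(** The cone over the part of z off the apex has boundary z. *)
Lemma full_cone_vanishes X v k : (forall s, s \in X -> v \notin s) ->
  reduced_homology_vanishes (X :|: cone v X) k.
Proof.
move=> vX z hz z0; have [zo y0] := boundary_off v z0.
exists (cone_chain v (off v z)); first exact/chain_cone/chain_off.
rewrite boundary_cone => [|s vs]; last by rewrite ffunE vs.
rewrite zo [RHS](chain_decomp v z); congr (_ + _).
by rewrite -[in RHS](opprK (link_chain v z)) !cone_chainN.
Qed.

Lemma no_face_vanishes K k : (forall s, s \in K -> fdim s <> k) ->
  reduced_homology_vanishes K k.
Proof.
move=> hK z hz _; have -> : z = 0.
  apply/ffunP=> s; rewrite ffunE; apply/eqP; apply: contraT => /hz[sK] /(hK _ sK) //.
by exists 0; [apply: chain0|apply: boundary0].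
Qed.

(** The homological half of Cohen-Macaulayness for a pure part, where the link of t has dimension i
    - |t|. *)
Definition links_vanish (i : int) K := forall t (k : int),
  t \in K -> k <> i - #|t|%:Z -> reduced_homology_vanishes (link K t) k.

(** * Pure parts and their links *)

Lemma pure_partP i G t :
  reflect (exists s, [/\ s \in G, fdim s = i & t \subset s]) (t \in pure_part i G).
Proof.
rewrite inE; apply: (iffP exists_inP) => [[s sG /andP[/eqP si ts]]|[s [sG si ts]]]; exists s => //.
by rewrite si eqxx.
Qed.

Lemma simplicial_pure_part i G : simplicial_complex (pure_part i G).
Proof.
move=> s t /pure_partP[u [uG ui su]] ts; apply/pure_partP; exists u; split=> //.
exact: subset_trans su.
Qed.

Lemma linkE K t s : simplicial_complex K ->
  (s \in link K t) = [disjoint s & t] && (s :|: t \in K).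
Proof.
move=> hK; rewrite inE andbA andbAC; case sK: (s :|: t \in K); rewrite ?andbF //.
by rewrite (hK _ _ sK) ?subsetUl //= andbT.
Qed.

Lemma dim_link_pure_part i G t : t \in pure_part i G ->
  dim (link (pure_part i G) t) = i - #|t|%:Z.
Proof.
move=> tK; have hK := @simplicial_pure_part i G.
have /pure_partP[s [sG si ts]] := tK.
have sK : s :\: t \in link (pure_part i G) t.
  rewrite linkE // disjoints_subset {1}setDE subsetIr -{2}(setIidPr ts) setUC setID.
  by apply/pure_partP; exists s.
have st := cardsDS ts; have le_ts := subset_leq_card ts.
rewrite (@dim_eq _ _ #|s :\: t| _ _ sK) // => [|u]; first by rewrite /fdim in si; lia.
rewrite linkE // => /andP[ut /pure_partP[w [_ wi /subset_leq_card uw]]].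
have := cardsUI u t; rewrite (disjoint_setI0 ut) cards0.
by rewrite /fdim in si wi; lia.
Qed.

Lemma cohen_macaulay_pure_part i G :
  cohen_macaulay (pure_part i G) <-> links_vanish i (pure_part i G).
Proof.
split=> [[_ h] t k tK|h].
  by rewrite -(dim_link_pure_part tK); apply: h.
split=> [s /facetP[sK maxs]|t k tK]; last by rewrite dim_link_pure_part //; apply: h.
have /pure_partP[u [uG ui su]] := sK.
have uK : u \in pure_part i G by apply/pure_partP; exists u.
rewrite -(maxs _ uK su) /fdim; apply/esym/(dim_eq _ uK) => // t /pure_partP[w [_ wi tw]].
by have := subset_leq_card tw; rewrite -ui /fdim in wi; lia.
Qed.

Lemma setD1id v t : v \notin t -> t :\ v = t.
Proof. by move=> vt; apply/setDidPl; rewrite disjoint_sym disjoints1. Qed.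

(** For t through v the link is that of t :\ v in [L]; for t outside [L] and off v it is the link in
    [X]; for t in [L] it is the link in [X] with a cone over the link in [L] attached, and
    [cone_vanishes] applies. *)
Lemma links_vanish_cone i X L v :
  simplicial_complex X -> simplicial_complex L ->
  (forall s, s \in X -> v \notin s) -> L \subset X ->
  links_vanish i X -> links_vanish (i - 1) L -> links_vanish i (X :|: cone v L).
Proof.
move=> sX sL vX LX hX hL t k; rewrite coneE //.
have sY := simplicial_cone vX LX sX sL.
have [vt tL|vt tX] := boolP (v \in t).
  have -> : link (X :|: cone v L) t = link L (t :\ v).
    apply/setP=> s; rewrite !linkE // coneE // inE vt orbT -!setI_eq0 setIDA setDUl.
    have [vs|vs] := boolP (v \in s); last by rewrite (setD1id vs) (@setD1id v (s :&: t)) // inE (negbTE vs).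
    have -> : (s :|: t :\ v \in L) = false.
      by apply: contraTF isT => /(notin_link vX LX); rewrite inE vs.
    rewrite andbF; apply/negbTE; rewrite negb_and; apply/orP; left.
    by apply/set0Pn; exists v; rewrite inE vs.
  by move=> ki; apply: hL => //; have := cardsD1 v t; rewrite vt; lia.
move=> ki; have [tL|tL] := boolP (t \in L); last first.
  have -> : link (X :|: cone v L) t = link X t; last exact: hX.
  apply/setP=> s; rewrite !linkE // coneE // inE (negbTE vt) orbF; congr (_ && _).
  case: ifP => // vs; have -> : ((s :|: t) :\ v \in L) = false.
    by apply: contraNF tL => h; apply: sL h _; rewrite subsetD1 subsetUr.
  by apply/esym/negP=> /vX; rewrite inE vs.
have vlX s : s \in link X t -> v \notin s by rewrite inE => /andP[/vX].
have llX : link L t \subset link X t.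
  by apply/subsetP=> s; rewrite !linkE // => /andP[->] /(subsetP LX).
have -> : link (X :|: cone v L) t = link X t :|: cone v (link L t).
  apply/setP=> s; rewrite coneE // !linkE // coneE // inE (negbTE vt) orbF.
  case: ifP => // vs; rewrite -!setI_eq0 setDUl (setD1id vt) [(s :\ v) :&: t]setIC setIDA.
  by rewrite (@setD1id v (t :&: s)) 1?[t :&: s]setIC // inE (negbTE vt) andbF.
apply: cone_vanishes => //; last exact: hX.
by apply: hL => //; lia.
Qed.

(** The inclusion hypothesis takes care of the faces of v |: s that avoid v. *)
Lemma pure_part_cone i D L v : (forall s, s \in D -> v \notin s) -> L \subset D ->
  pure_part (i - 1) L \subset pure_part i D ->
  pure_part i (D :|: cone v L) = pure_part i D :|: cone v (pure_part (i - 1) L).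
Proof.
move=> vD LD sub.
have vP s : s \in pure_part i D -> v \notin s.
  by move=> /pure_partP[t [/vD vt _ st]]; apply: contra vt; apply: subsetP.
apply/setP=> t; rewrite coneE //; apply/pure_partP/idP => [[s []]|].
  rewrite coneE //; case: ifP => vs sG si ts; last first.
    have vt : v \notin t by apply: contraFN vs; apply: subsetP.
    by rewrite (negbTE vt); apply/pure_partP; exists s.
  have si' : fdim (s :\ v) = i - 1.
    by rewrite -si -[s in RHS](setD1K vs) fdimU1 ?setD11 // addrK.
  case: ifP => vt; first by apply/pure_partP; exists (s :\ v); rewrite setSD.
  by apply: (subsetP sub); apply/pure_partP; exists (s :\ v); rewrite subsetD1 vt ts.
case: ifP => vt /pure_partP[s [sD si ts]]; last first.
  by exists s; rewrite coneE // (negbTE (vD _ sD)).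
have vs := notin_link vD LD sD; exists (v |: s); split.
- by rewrite coneE // setU11 setU1K.
- by rewrite fdimU1 // si subrK.
- by rewrite -subDset.
Qed.

Lemma powerset_cone A v : v \in A ->
  powerset A = powerset (A :\ v) :|: cone v (powerset (A :\ v)).
Proof.
move=> vA; apply/setP=> s; rewrite coneE //; last first.
  by move=> t; rewrite inE subsetD1 => /andP[].
case: ifP => vs; rewrite !inE ?subsetD1 ?vs ?andbT //.
by rewrite setD11 andbT subDset (setUidPr _) ?sub1set.
Qed.

(** By induction on |A|: below the top dimension the pure part is a skeleton, obtained from
    skeletons of A :\ v by a cone step; in the top dimension the links are simplices, which are
    cones unless their vertex set is empty. *)
Lemma links_vanish_simplex i A : links_vanish i (pure_part i (powerset A)).
Proof.
have [n] := ubnP #|A|; elim: n A i => // n IH A i leAn t k tK ki.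
have /pure_partP[s [sA si ts]] := tK; rewrite inE in sA.
have [A0|[v vA]] := set_0Vmem A.
  apply: no_face_vanishes => u; rewrite linkE; last exact: simplicial_pure_part.
  case/andP=> _ /pure_partP[w [wA wi uw]] uk; apply: ki.
  rewrite A0 !inE !subset0 in sA wA; move: ts uw si uk.
  rewrite (eqP sA) (eqP wA) !subset0 setU_eq0 /fdim => /eqP-> /andP[/eqP-> _] <- <-.
  by rewrite cards0.
have AD : #|A| = #|A :\ v|.+1 by rewrite (cardsD1 v A) vA.
have IHv j : links_vanish j (pure_part j (powerset (A :\ v))).
  by apply: IH; rewrite -ltnS -AD.
have vD (u : {set V}) : u \in powerset (A :\ v) -> v \notin u by rewrite inE subsetD1 => /andP[].
have [lt|ge] := ltnP #|s| #|A|.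
  have sub : pure_part (i - 1) (powerset (A :\ v)) \subset pure_part i (powerset (A :\ v)).
    apply/subsetP=> u /pure_partP[w [wA wi uw]]; rewrite inE in wA.
    have ww : (#|w| < #|A :\ v|)%N by rewrite /fdim in si wi; lia.
    have /properP[_ [x xA xw]] : w \proper A :\ v by rewrite properEcard wA.
    apply/pure_partP; exists (x |: w); split.
    - by rewrite inE subUset sub1set xA.
    - by rewrite fdimU1 // wi subrK.
    - exact: subset_trans uw (subsetUr _ _).
  move: tK ki; rewrite (powerset_cone vA) pure_part_cone //.
  apply: links_vanish_cone => //; try exact: simplicial_pure_part.
  by move=> u /pure_partP[w [/vD vw _ uw]]; apply: contra vw; apply: subsetP.
have {sA}sA : s = A by apply/eqP; rewrite eqEcard sA ge.
have -> : pure_part i (powerset A) = powerset A.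
  apply/setP=> u; rewrite [RHS]inE; apply/pure_partP/idP => [[w [wA _ uw]]|uA].
    by rewrite inE in wA; apply: subset_trans wA.
  by exists A; split=> //; [rewrite inE|rewrite -sA].
have -> : link (powerset A) t = powerset (A :\: t).
  apply/setP=> u; rewrite linkE; last by move=> w w' /[!inE] wA; move/subset_trans; apply.
  by rewrite !inE subUset -{2}sA ts andbT subsetD andbC.
have [A0|[w wA]] := set_0Vmem (A :\: t).
  apply: no_face_vanishes => u; rewrite A0 inE subset0 => /eqP-> uk; apply: ki.
  have E : t = A by apply/eqP; rewrite eqEsubset -{1}sA ts -setD_eq0 A0 eqxx.
  by rewrite -uk -si sA E /fdim cards0; lia.
rewrite (powerset_cone wA); apply: full_cone_vanishes => u.
by rewrite inE subsetD1 => /andP[].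
Qed.

(** Shedding enlarges each (i-1)-face of [L] to an i-face of [D], so taking pure parts commutes with
    the cone step. *)
Lemma vd_scm G : vertex_decomposable G -> sequentially_cohen_macaulay G.
Proof.
move=> vdG i; apply/cohen_macaulay_pure_part; elim: vdG i => [A|D L v _ hD _ hL LD vD shed] i.
  exact: links_vanish_simplex.
have sub : pure_part (i - 1) L \subset pure_part i D.
  apply/subsetP=> t /pure_partP[s [sL si ts]]; have [w ws wD] := shed _ sL.
  apply/pure_partP; exists (w |: s); split=> //; first by rewrite fdimU1 // si subrK.
  exact: subset_trans ts (subsetUr _ _).
rewrite pure_part_cone //; apply: links_vanish_cone => //; try exact: simplicial_pure_part.
by move=> s /pure_partP[t [/vD vt _ st]]; apply: contra vt; apply: subsetP.
Qed.

(** The transpose of [boundary], on cochains without any support condition. *)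
Definition coboundary (g : {set V} -> int) s : int :=
  \sum_(v in s) sgn v (s :\ v) * g (s :\ v).

Lemma pair_boundary (phi : {set V} -> int) b :
  \sum_t phi t * boundary b t = \sum_s coboundary phi s * b s.
Proof.
under eq_bigr do rewrite boundaryE mulr_sumr.
under [RHS]eq_bigr do rewrite mulr_suml.
rewrite (exchange_big_dep predT) //= [RHS](exchange_big_dep predT) //=.
apply: eq_bigr => v _; rewrite (reindex_onto (fun s => s :\ v) (fun t => v |: t)) /=.
  apply: eq_big => [s|s /andP[_ /eqP E]]; last by rewrite E mulrCA mulrA.
  rewrite setD11 /=; apply/eqP/idP => [<-|vs]; [exact: setU11|exact: setD1K].
by move=> t vt; rewrite setU1K.
Qed.

(** Exchanging the two removed vertices shows that the sum equals its own opposite. *)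
Lemma coboundary_coboundary g s : coboundary (coboundary g) s = 0.
Proof.
pose G u v := sgn v (s :\ v) * (sgn u ((s :\ v) :\ u) * g ((s :\ v) :\ u)).
have GE : coboundary (coboundary g) s = \sum_(v in s) \sum_(u in s | u != v) G u v.
  apply: eq_bigr => v vs; rewrite mulr_sumr; apply: eq_bigl => u.
  by rewrite !inE andbC.
have E : \sum_(v in s) \sum_(u in s | u != v) G u v = - \sum_(v in s) \sum_(u in s | u != v) G u v.
  rewrite {1}(exchange_big_dep (mem s)) /=; last by move=> v u _ /andP[].
  rewrite -sumrN; apply: eq_bigr => u us; rewrite -sumrN.
  apply: eq_big => [v|v /andP[vs uv]]; first by rewrite us eq_sym.
  rewrite us /= in uv.
  rewrite /G !mulrA -mulNr (_ : (s :\ v) :\ u = (s :\ u) :\ v); last first.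
    by apply/setP=> y; rewrite !inE andbCA.
  congr (_ * _); set r := (s :\ u) :\ v.
  have -> : s :\ v = u |: r.
    by apply/setP=> y; rewrite !inE; case: (eqVneq y u) => [->|]; rewrite ?us ?uv.
  have -> : s :\ u = v |: r by rewrite setD1K // !inE eq_sym uv.
  by rewrite sgn_swap // ?inE ?eqxx ?andbF // eq_sym.
rewrite GE; lia.
Qed.

(* A cochain that is a coboundary on the boundary of each face annihilates
   every boundary. *)
Lemma locally_coboundary_kills K (k : int) (phi : {set V} -> int) z :
  (forall s, s \in K -> fdim s = k + 1 ->
     exists g, forall v, v \in s -> phi (s :\ v) = coboundary g (s :\ v)) ->
  reduced_homology_vanishes K k -> chain K k z -> boundary z = 0 ->
  \sum_t phi t * z t = 0.
Proof.
move=> loc van hz z0; have [b hb <-] := van z hz z0.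
rewrite pair_boundary big1 // => s _; have [->|/hb[sK sk]] := eqVneq (b s) 0; first by rewrite mulr0.
have [g hg] := loc s sK sk; rewrite -[RHS](mul0r (b s)) -(coboundary_coboundary g s).
by congr (_ * _); apply: eq_bigr => v vs; rewrite hg.
Qed.

(** * Chains supported on points and edges *)

Definition single s : {ffun {set V} -> int} := [ffun t => (t == s)%:R].

Lemma pair_single (phi : {set V} -> int) s : \sum_t phi t * single s t = phi s.
Proof.
rewrite (bigD1 s) //= big1 => [|t ts]; last by rewrite ffunE (negbTE ts) mulr0.
by rewrite ffunE eqxx mulr1 addr0.
Qed.

Lemma boundary_single s t :
  boundary (single s) t = \sum_(v in s) sgn v (s :\ v) * single (s :\ v) t.
Proof.
rewrite boundaryE big_mkcond [RHS]big_mkcond /=; apply: eq_bigr => v _; rewrite !ffunE.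
have [vs|vs] := boolP (v \in s); have [vt|vt] := boolP (v \in t) => //=.
- by case: eqP => [tE|_]; [rewrite tE setD11 in vt|rewrite mulr0].
- have [->|ne] := eqVneq t (s :\ v); first by rewrite setD1K // eqxx.
  by case: eqP => [E|_]; [rewrite -E setU1K // eqxx in ne|rewrite !mulr0].
by case: eqP => [E|_]; [rewrite -E setU11 in vs|rewrite mulr0].
Qed.

Lemma sgn0 x : sgn x set0 = 1.
Proof. by rewrite /sgn (_ : [set w in _ | _] = set0) ?cards0 //; apply/setP=> w; rewrite !inE. Qed.

Lemma boundary_point v : boundary (single [set v]) = single set0.
Proof.
by apply/ffunP=> t; rewrite boundary_single big_set1 setDv sgn0 mul1r.
Qed.

(** The edge directed from x to y: the sign corrects the orientation given by [enum_rank]. *)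
Definition arc x y : {ffun {set V} -> int} := [ffun t => sgn x [set y] * single [set x; y] t].

Lemma set2D1 x y : x != y -> ([set x; y] :\ x = [set y]) * ([set x; y] :\ y = [set x]).
Proof.
by move=> xy; rewrite {2}setUC !setU1K // inE // eq_sym.
Qed.

Lemma sgn_set1 x y : x != y -> sgn x [set y] = - sgn y [set x].
Proof.
move=> xy; have := @sgn_swap x y set0 xy; rewrite !inE !setU0 !sgn0 !mulr1; exact.
Qed.

Lemma coboundary_set2 g x y : x != y ->
  coboundary g [set x; y] = sgn x [set y] * (g [set y] - g [set x]).
Proof.
move=> xy; rewrite /coboundary big_setU1 ?inE //= big_set1 !set2D1 //.
by rewrite (sgn_set1 xy); ring.
Qed.

Lemma boundary_arc x y : x != y -> boundary (arc x y) = single [set y] - single [set x].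
Proof.
move=> xy; apply/ffunP=> t; rewrite [RHS]ffunE [X in _ = _ + X]ffunE.
have -> : boundary (arc x y) t = sgn x [set y] * boundary (single [set x; y]) t.
  rewrite !boundaryE mulr_sumr; apply: eq_bigr => v _; rewrite [arc _ _ _]ffunE; ring.
rewrite boundary_single big_setU1 ?inE //= big_set1 !set2D1 //.
by rewrite mulrDr !mulrA sgn2 mul1r (sgn_set1 xy) !mulNr sgn2 mul1r.
Qed.

End Homology.

(** * Independence complexes of cycles *)

Section GraphDecomposable.
Variables (V : finType) (e : rel V).
Hypotheses (e_sym : symmetric e) (e_irr : irreflexive e).
Implicit Types (s t W : {set V}) (u v w x y : V).

(** By induction on |W|, removing a shedding vertex w: the deletion is the complex of W :\ w, the
    link that of [W] without the closed neighbourhood of w. Without edges the complex is a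
    simplex. *)
Lemma good_vertex_decomposable W : good e W -> vertex_decomposable (indep e W).
Proof.
have [n] := ubnP #|W|; elim: n W => // n IH W leWn gW.
have IHv W' v : v \in W -> W' \subset W -> v \notin W' -> vertex_decomposable (indep e W').
  move=> vW W'W vW'; apply: IH.
    by rewrite -ltnS; apply: leq_trans leWn; apply/proper_card/properP; split=> //; exists v.
  by move=> C CW'; apply: gW; apply: subset_trans W'W.
have [/exists_inP[u uW /exists_inP[v vW euv]]|noe] := boolP [exists u in W, exists v in W, e u v].
  have [w wW shed] := exists_shedding e_sym e_irr gW uW vW euv.
  have -> : indep e W = indep e (W :\ w) :|: cone w (indep e (W :\: (w |: [set x | e w x]))).
    have wD s : s \in indep e (W :\ w) -> w \notin s.
      by case/indepP; rewrite subsetD1 => /andP[].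
    have LD : indep e (W :\: (w |: [set x | e w x])) \subset indep e (W :\ w).
      apply/subsetP=> s /indepP[sW si]; apply/indepP; split=> //.
      by apply: subset_trans sW _; apply: setDS; apply: subsetUl.
    apply/setP=> s; rewrite coneE //; have [ws|ws] := boolP (w \in s); apply/indepP/indepP.
    - case=> sW si; split; last by move=> x y /setD1P[_ xs] /setD1P[_]; apply: si.
      apply/subsetP=> x /setD1P[xw xs]; rewrite !inE negb_or xw (subsetP sW) //= andbT.
      exact: si.
    - case=> sW si; have sP x : x \in s -> x != w -> [/\ x \in W & ~~ e w x].
        move=> xs xw; have /(subsetP sW) : x \in s :\ w by rewrite !inE xw.
        by rewrite !inE negb_or => /andP[/andP[]].
      split=> [|x y xs ys].
        by apply/subsetP=> x xs; have [->//|/(sP _ xs)[]] := eqVneq x w.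
      have [->|xw] := eqVneq x w; have [->|yw] := eqVneq y w; rewrite ?e_irr //.
      + by have [] := sP _ ys yw.
      + by rewrite e_sym; have [] := sP _ xs xw.
      + by apply: si; rewrite !inE ?xw ?yw.
    - by case=> sW si; split=> //; rewrite subsetD1 sW.
    - by case=> sW si; split=> //; apply: subset_trans sW (subsetDl _ _).
  apply: vd_shed.
  - by apply: (IHv _ w); rewrite ?subsetDl // setD11.
  - by apply: (IHv _ w); rewrite ?subsetDl // !inE eqxx.
  - apply/subsetP=> s /indepP[sW si]; apply/indepP; split=> //.
    by apply: subset_trans sW _; apply: setDS; apply: subsetUl.
  - by move=> s /indepP[]; rewrite subsetD1 => /andP[].
  - by move=> s /shed[x [xs _ xsD]]; exists x.
have -> : indep e W = powerset W; last exact: vd_simplex.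
apply/setP=> s; rewrite [RHS]inE; apply/indepP/idP => [[]//|sW]; split=> // x y xs ys.
apply: contra noe => exy; apply/exists_inP; exists x; first exact: (subsetP sW).
by apply/exists_inP; exists y => //; apply: (subsetP sW).
Qed.

Lemma simplicial_indep W : simplicial_complex (indep e W).
Proof.
move=> s t /indepP[sW si] ts; apply/indepP; split; first exact: subset_trans sW.
by move=> x y xt yt; apply: si; apply: (subsetP ts).
Qed.

End GraphDecomposable.

(** * The alternating sets of a cycle *)

Section Cycle.
Variables (V : finType) (e : rel V) (n : nat) (f : 'I_n.+4 -> V).
Hypotheses (f_inj : injective f) (eE : forall i j, e (f i) (f j) = (j == i + 1)%R || (i == j + 1)%R).
Local Notation N := n.+4.
Let C : {set V} := f @: setT.
Let K := indep e C.
Implicit Types (p q x y : 'I_N) (s t : {set V}).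

(** The positions p+1, p+3, ..., by parity of the representative of x - p below N. For N odd the
    alternation breaks at the consecutive missing positions p - 1 and p. *)
Definition alt p : {set 'I_N} := [set x : 'I_N | odd (x - p)%R].
Definition F p : {set V} := f @: alt p.

Lemma mem_F p x : (f x \in F p) = odd (x - p)%R.
Proof. by rewrite mem_imset // inE. Qed.

Lemma odd_succ p x : odd (x + 1 - p)%R = if (x + 1 == p)%R then false else ~~ odd (x - p)%R.
Proof.
rewrite -subr_eq0 (_ : x + 1 - p = x - p + 1)%R; last by rewrite addrAC.
set y := (x - p)%R; rewrite -val_eqE [val (y + 1)%R]val_succ.
rewrite [\val (y + 1)%R in RHS]val_succ. by case: ifP.
Qed.

Lemma odd_pred p x : x != p -> odd (x - 1 - p)%R = ~~ odd (x - p)%R.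
Proof. by move=> xp; have := odd_succ p (x - 1)%R; rewrite subrK (negbTE xp) => ->; rewrite negbK. Qed.

Lemma card_alt p : #|alt p| = N./2.
Proof.
have -> : alt p = (fun x => x + p)%R @: [set x : 'I_N | odd x].
  apply/setP=> x; rewrite inE; apply/idP/imsetP => [xo|[y yo ->]].
    by exists (x - p)%R; rewrite ?inE // subrK.
  by rewrite addrK; rewrite inE in yo.
rewrite card_imset; last exact: addIr.
rewrite cardsE -sum1_card (eq_bigl (fun i : 'I_N => odd i)) // big_mkcond /=.
have -> : \sum_(i < N) (if odd i then 1 else 0) = \sum_(i < N) odd i.
  by apply: eq_bigr => i _; case: odd.
suff h m : \sum_(i < m) odd i = m./2 by exact: h.
elim: m => [|m IH]; first by rewrite big_ord0.
by rewrite big_ord_recr /= IH; lia.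
Qed.

Lemma card_F p : #|F p| = N./2.
Proof. by rewrite card_imset // card_alt. Qed.

Lemma F_indep p : F p \in K.
Proof.
apply/indepP; split; first exact: imsetS.
move=> _ _ /imsetP[x xp ->] /imsetP[y yp ->]; rewrite eE; rewrite !inE in xp yp.
by apply/norP; split; apply/eqP=> E; move: xp yp; rewrite E odd_succ; case: ifP => // _; case: odd.
Qed.

(** The position set [T] and its shift [T1] are disjoint, whence the bound. In case of equality they
    miss at most one position, and the alternation is forced from there. *)
Lemma max_indep s : s \in K -> (#|s| <= N./2)%N /\ (#|s| = N./2 -> exists p, s = F p).
Proof.
case/indepP=> sC si; set T := f @^-1: s.
have sE : s = f @: T.
  apply/setP=> v; apply/idP/imsetP => [vs|[x xT ->]]; last by rewrite inE in xT.
  have /imsetP[x _ vx] := subsetP sC _ vs; exists x => //; by rewrite inE -vx.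
have sT : #|s| = #|T| by rewrite sE card_imset.
pose T1 := (fun x => x + 1)%R @: T.
have memT1 x : (x + 1 \in T1)%R = (x \in T) by apply: (mem_imset T x (addIr 1%R)).
have TS x : x \in T -> (x + 1)%R \notin T.
  move=> xT; apply/negP=> x1T; rewrite !inE in xT x1T.
  by have := si _ _ xT x1T; rewrite eE eqxx.
have dT : T :&: T1 = set0.
  apply/setP=> x; rewrite !inE -[x](subrK 1%R) memT1 subrK; apply/negP=> /andP[xT /TS].
  by rewrite subrK inE xT.
have cT1 : #|T1| = #|T| by rewrite card_imset //; exact: addIr.
have := cardsUI T T1; rewrite dT cards0 addn0 cT1 => cU.
have cN : (#|T :|: T1| <= N)%N by rewrite -[leqRHS](card_ord N) max_card.
split; first by rewrite sT; lia.
rewrite sT => cT.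
(* The starting point p is the position missed by both [T] and [T1], or any position outside [T] if
   none is missed. *)
have [p pT pU] : exists2 p, p \notin T & forall x, (x + 1 != p)%R -> (x + 1 \in T)%R = (x \notin T).
  have MM p : p \notin T -> ~: (T :|: T1) \subset [set p] -> 
     exists2 p, p \notin T & forall x, (x + 1 != p)%R -> (x + 1 \in T)%R = (x \notin T).
    move=> pT Mp; exists p => // x xp; apply/idP/idP => [|xT]; first by apply: contraL => /TS.
    have : (x + 1)%R \notin ~: (T :|: T1) by apply: contra xp => /(subsetP Mp)/set1P->.
    by rewrite inE negbK inE memT1 (negbTE xT) orbF.
  have [M0|[p pM]] := set_0Vmem (~: (T :|: T1)).
    have [p pT] : exists p, p \notin T.
      apply/existsP; rewrite -negb_forall; apply/negP=> /forallP h.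
      by have := h 0%R => /TS; rewrite h.
    by apply: (MM p pT); rewrite M0 sub0set.
  apply: (MM p); first by move: pM; rewrite !inE negb_or => /andP[].
  rewrite (_ : ~: _ = [set p]) //; apply/esym/eqP; rewrite eqEcard sub1set pM cards1.
  by have := cardsC (T :|: T1); rewrite card_ord; lia.
exists p; rewrite sE; suff -> : T = alt p by [].
apply/setP=> x; rewrite [RHS]inE.
rewrite -[x](subrK p) addrK; move: (x - p)%R => {}x.
(* Induction on the residue of x - p, starting at p itself, which is not in [T]. *)
case: x => k hk; elim: k hk => [|k IH] hk.
  by rewrite (_ : Ordinal hk = 0%R) ?add0r ?(negbTE pT) //; apply: val_inj.
have xE : Ordinal hk = (Ordinal (ltnW hk) + 1)%R.
  by apply: val_inj; rewrite val_succ -val_eqE /=; case: eqP => //; lia.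
rewrite xE addrAC pU -?xE ?IH // addrAC -xE -subr_eq0 addrK.
by rewrite -val_eqE.
Qed.

Lemma opp1_ord_max : (- 1 : 'I_N)%R = ord_max.
Proof.
apply/eqP; have := val_succ (- 1 : 'I_N)%R; rewrite addNr /=; by case: eqP.
Qed.

Lemma odd_opp1 : odd (- 1 : 'I_N)%R = ~~ odd N.
Proof. by rewrite opp1_ord_max /= !negbK. Qed.

Lemma one_neq0 : (1 != 0 :> 'I_N)%R. Proof. by rewrite -val_eqE. Qed.
Lemma two_neq0 : (1 + 1 != 0 :> 'I_N)%R. Proof. by rewrite -val_eqE. Qed.
Lemma three_neq0 : (1 + 1 + 1 != 0 :> 'I_N)%R. Proof. by rewrite -val_eqE. Qed.

Lemma F_facet p : F p \in facets K.
Proof.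
apply/facetP; split=> [|t tK Ft]; first exact: F_indep.
by apply/esym/eqP; rewrite eqEcard Ft card_F; have [] := max_indep tK.
Qed.

Lemma facet_F s p : s \in facets K -> F p \subset s -> s = F p.
Proof. by case/facetP=> sK _; case/facetP: (F_facet p) => _; apply. Qed.

(** As s is independent, a neighbour of y in [F p] can only be the removed vertex. *)
Lemma facet_ridge p a s y : s \in facets K -> F p :\ a \subset s -> f y \in s ->
  (f (y + 1)%R \in F p -> f (y + 1)%R = a) /\ (f (y - 1)%R \in F p -> f (y - 1)%R = a).
Proof.
case/facetP=> /indepP[_ si] _ rs ys; split=> h; apply/eqP; apply: contraT => ne.
  by have := si _ _ ys (subsetP rs (f (y + 1)%R) _); rewrite eE eqxx !inE ne h; apply.
have := si _ _ ys (subsetP rs (f (y - 1)%R) _).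
by rewrite eE subrK eqxx orbT !inE ne h; apply.
Qed.

Lemma sub_F s p : s \in facets K -> (forall y, f y \in s -> odd (y - p)%R) -> s = F p.
Proof.
move=> sF h; case/facetP: (sF) => /indepP[sC _] max; apply/esym/max; first exact: F_indep.
by apply/subsetP=> v vs; have /imsetP[x _ E] := subsetP sC _ vs; rewrite E mem_F h // -E.
Qed.

(** * Cycles are not partitionable *)

Section Partition.
Variable tau : {set V} -> {set V}.
Hypothesis tau_sub : forall s, s \in facets K -> tau s \subset s.
Hypothesis tau_cover : forall t, t \in K ->
  exists2 s, s \in facets K & t \in interval (tau s) s.
Hypothesis tau_disj : forall s s' t, s \in facets K -> s' \in facets K ->
  t \in interval (tau s) s -> t \in interval (tau s') s' -> s = s'.

(** The facet whose interval contains the ridge; it differs from [F p] when a belongs to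
    [tau (F p)]. *)
Lemma ridge_facet p a : a \in F p ->
  exists s, [/\ s \in facets K, F p :\ a \subset s & tau s \subset F p :\ a].
Proof.
move=> aF; have [|s sF] := tau_cover (t := F p :\ a).
  exact: simplicial_indep (F_indep p) (subD1set _ _).
by rewrite inE => /andP[]; exists s.
Qed.

(** For N even a ridge of [F p] lies in no other facet, so [tau (F p)] is empty for every p; the
    empty face then lies in the intervals of both [F 0] and [F 1]. *)
Lemma even_not_partition : ~~ odd N -> False.
Proof.
move=> Ne; have oS q x : odd (x + 1 - q)%R = ~~ odd (x - q)%R.
  by rewrite odd_succ; case: eqP => // <-; rewrite opprD addrA subrr add0r odd_opp1 Ne.
have tau0 p : tau (F p) = set0.
  apply/setP=> a; rewrite [RHS]inE; apply/negP=> ta.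
  have aF := subsetP (tau_sub (F_facet p)) _ ta.
  have [s [sF rs ts]] := ridge_facet aF.
  suff sE : s = F p by rewrite sE in ts; have := subsetP ts _ ta; rewrite !inE eqxx.
  apply: sub_F => // y ys; apply: contraT => oy.
  have [h1 h2] := facet_ridge sF rs ys.
  have := h1; rewrite mem_F oS => /(_ oy) E1.
  have := h2; rewrite mem_F -[odd _]negbK -oS subrK => /(_ oy); rewrite -E1 => /f_inj/eqP.
  by rewrite eq_sym -subr_eq0 (_ : _ - _ = 1 + 1)%R ?(negbTE two_neq0) //; ring.
have : F 0%R = F 1%R.
  by apply: (tau_disj (t := set0)); rewrite ?F_facet // inE tau0 !sub0set.
by move/setP/(_ (f 0%R)); rewrite !mem_F subrr sub0r odd_opp1 Ne.
Qed.

Hypothesis Nodd : odd N.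

(** The set [F p] determines p: only there are both p - 1 and p missing. *)
Lemma F_inj : injective F.
Proof.
move=> p q E; apply/eqP; apply: contraT => pq.
have : f p \in F p = false by rewrite mem_F subrr.
have : f (p - 1)%R \in F p = false by rewrite mem_F addrAC subrr sub0r odd_opp1 Nodd.
by rewrite E !mem_F odd_pred // => /negbFE->.
Qed.

(** The vertices a p and b p are the two ends of the alternating set [F p]. *)
Let a p := f (p + 1)%R.
Let b p := f (p - 1 - 1)%R.

Lemma aF p : a p \in F p. Proof. by rewrite mem_F addrAC subrr add0r. Qed.
Lemma bF p : b p \in F p.
Proof.
rewrite mem_F odd_pred; first by rewrite addrAC subrr sub0r odd_opp1 Nodd.
by rewrite -subr_eq0 addrAC subrr sub0r oppr_eq0 one_neq0.
Qed.

Lemma ab_neq p : a p != b p.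
Proof.
apply/eqP=> /f_inj/eqP; rewrite -subr_eq0 (_ : _ - _ = 1 + 1 + 1)%R ?(negbTE three_neq0) //.
by ring.
Qed.

(** A vertex outside [F p] has both neighbours in [F p], hence equal to c, which is absurd, unless
    its position is p or p - 1. *)
Lemma odd_ridge_facet p c s y : s \in facets K -> F p :\ c \subset s -> f y \in s ->
  [\/ odd (y - p)%R, y = p /\ c = a p | c = b p].
Proof.
move=> sF rs ys; have [h1 h2] := facet_ridge sF rs ys.
have [|oy] := boolP (odd (y - p)%R); first by constructor 1.
have [yp|yp] := eqVneq y p.
  constructor 2; split=> //; rewrite -h1 yp //; exact: aF.
have E2 := h2; rewrite mem_F odd_pred // in E2; have {}E2 := E2 oy.
have [y1p|y1p] := eqVneq (y + 1)%R p.
  by constructor 3; rewrite -E2 /b -y1p addrK.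
have := h1; rewrite mem_F odd_succ (negbTE y1p) => /(_ oy); rewrite -E2 => /f_inj/eqP.
by rewrite -subr_eq0 (_ : _ - _ = 1 + 1)%R ?(negbTE two_neq0) //; ring.
Qed.

Lemma tau_ab p : tau (F p) \subset [set a p; b p].
Proof.
apply/subsetP=> c tc; apply: contraT; rewrite !inE negb_or => /andP[ca cb].
have cF := subsetP (tau_sub (F_facet p)) _ tc.
have [s [sF rs ts]] := ridge_facet cF.
suff sE : s = F p by rewrite sE in ts; have := subsetP ts _ tc; rewrite !inE eqxx.
apply: sub_F => // y ys.
by case: (odd_ridge_facet sF rs ys) => // [[_ E]|E]; rewrite E eqxx in ca cb.
Qed.

(** Removing a p from [F p] or b (p + 2) from [F (p + 2)] leaves the same ridge, which lies in no
    third facet and belongs to the interval of one of the two. *)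
Lemma tau_consecutive p : ((a p \in tau (F p)) + (b (p + 1 + 1)%R \in tau (F (p + 1 + 1)%R)) <= 1)%N.
Proof.
have [s [sF rs ts]] := ridge_facet (aF p).
have bE : b (p + 1 + 1)%R = f p by rewrite /b !addrK.
have [ps|ps] := boolP (f p \in s); last first.
  have sE : s = F p.
    apply: sub_F => // y ys; case: (odd_ridge_facet sF rs ys) => // [[yp _]|E].
      by rewrite -yp ys in ps.
    by have := ab_neq p; rewrite E eqxx.
  rewrite sE in ts; case: (boolP (a p \in _)) => [/(subsetP ts)|_]; first by rewrite !inE eqxx.
  exact: leq_b1.
have sE : s = F (p + 1 + 1)%R.
  apply: facet_F => //; apply/subsetP=> c /imsetP[x]; rewrite inE => xo ->.
  have [->//|xp] := eqVneq x p.
  have x1 : x != (p + 1)%R.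
    apply: contraTneq xo => ->.
    by rewrite (_ : _ - _ = - 1)%R ?odd_opp1 ?Nodd //; ring.
  apply: (subsetP rs); rewrite !inE (inj_eq f_inj) x1 mem_F /=.
  have := xo; rewrite (_ : x - _ = x - 1 - 1 - p)%R; last by ring.
  by rewrite !odd_pred ?negbK // subr_eq.
rewrite sE bE in ts *; case: (boolP (f p \in _)) => [/(subsetP ts)|_]; last by rewrite addn0 leq_b1.
by rewrite !inE mem_F subrr andbF.
Qed.

Definition singles p : {set V} := [set v | [set v] \in interval (tau (F p)) (F p)].

(** By [tau_ab], [tau (F p)] has two, one or no elements; the interval then contains no, one or all
    N./2 singletons of [F p]. *)
Lemma card_singles p : (2 < N./2)%N ->
  (2 + (tau (F p) == set0) <= #|singles p| + ((a p \in tau (F p)) + (b p \in tau (F p))))%N.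
Proof.
move=> N3; have tab := tau_ab p.
have tP v : v \in tau (F p) -> v = a p \/ v = b p.
  by move/(subsetP tab); rewrite !inE => /orP[]/eqP; [left|right].
have single v : v \in F p -> tau (F p) \subset [set v] -> (0 < #|singles p|)%N.
  by move=> vF tv; apply/card_gt0P; exists v; rewrite !inE tv sub1set.
have [aT|aT] := boolP (a p \in tau (F p)); have [bT|bT] := boolP (b p \in tau (F p)).
- by case: eqP => [t0|_]; [rewrite t0 inE in aT|exact: leq_addl].
- have h : (0 < #|singles p|)%N.
    apply: (single _ (aF p)); apply/subsetP=> v vT; rewrite inE.
    by case: (tP v vT) => E; rewrite E ?eqxx // in vT *; rewrite vT in bT.
  by case: eqP => [t0|_] /=; [rewrite t0 inE in aT|lia].
- have h : (0 < #|singles p|)%N.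
    apply: (single _ (bF p)); apply/subsetP=> v vT; rewrite inE.
    by case: (tP v vT) => E; rewrite E ?eqxx // in vT *; rewrite vT in aT.
  by case: eqP => [t0|_] /=; [rewrite t0 inE in bT|lia].
have t0 : tau (F p) = set0.
  apply/setP=> v; rewrite inE; apply/negP=> vT.
  by case: (tP v vT) => E; rewrite -E vT in aT bT.
rewrite t0 eqxx addn0; apply: leq_trans N3 _; rewrite -(card_F p) subset_leq_card //.
by apply/subsetP=> v vF; rewrite !inE t0 sub0set sub1set.
Qed.

Lemma odd_not_partition : (2 < N./2)%N -> False.
Proof.
move=> N3.
have sumS : (\sum_p #|singles p| = #|\bigcup_p singles p|)%N.
  rewrite -sum1_card partition_disjoint_bigcup /=; last first.
    move=> p q pq; apply/pred0P=> v; apply/negP=> /andP[] /=; rewrite !inE => h h'; case/negP: pq; apply/eqP/F_inj.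
    by apply: (tau_disj (t := [set v])); rewrite ?F_facet // inE.
  by apply: eq_bigr => p _; rewrite sum1_card.
have subC : \bigcup_p singles p \subset C.
  apply/bigcupsP=> p _; apply/subsetP=> v; rewrite !inE sub1set => /andP[_].
  by apply/subsetP/imsetS.
have cC : #|C| = N by rewrite card_imset // cardsT card_ord.
(* Shifting the index of the b-terms by 2 pairs them with the a-terms, each pair contributing at
   most 1. *)
have sumT : (\sum_p ((a p \in tau (F p)) + (b p \in tau (F p))) <= N)%N.
  rewrite big_split /= [X in (_ + X)%N](reindex_inj (addIr (1 + 1)%R)) /= -big_split /=.
  rewrite -[leqRHS](card_ord N) -sum1_card; apply: leq_sum => p _.
  by rewrite addrA; apply: tau_consecutive.
have lower : (\sum_p (2 + (tau (F p) == set0)) <=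
    \sum_p (#|singles p| + ((a p \in tau (F p)) + (b p \in tau (F p)))))%N.
  by apply: leq_sum => p _; apply: card_singles.
move: lower; rewrite big_split /= sum_nat_const card_ord [leqRHS]big_split /= sumS => lower.
pose U := #|\bigcup_p singles p|; pose E0 := (\sum_p (tau (F p) == set0))%N.
have {lower sumT}lower : (N * 2 + E0 <= U + N)%N := leq_trans lower (leq_add (leqnn _) sumT).
(* The bound forces U = N and E0 = 0. The facet s0 whose interval contains the empty face has empty
   [tau]: if it is some [F q] then E0 > 0, and otherwise its vertices are not counted in U. *)
have [|s0 s0F] := tau_cover (t := set0); first exact: simplicial_indep (F_indep 0%R) (sub0set _).
rewrite inE subset0 => /andP[/eqP t0 _].
have [/existsP[q /eqP s0q]|nq] := boolP [exists q, s0 == F q].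
  have : (0 < E0)%N by rewrite /E0 (bigD1 q) //= -s0q t0 eqxx.
  have := subset_leq_card subC; rewrite cC -/U; lia.
have [s00|[v vs]] := set_0Vmem s0.
  case/negP: nq; apply/existsP; exists 0%R; case/facetP: s0F => _ max.
  by rewrite (max (F 0%R)) ?F_indep // s00 sub0set.
have : v \notin \bigcup_p singles p.
  apply/bigcupP=> -[p _]; rewrite inE => vp; case/negP: nq; apply/existsP; exists p; apply/eqP.
  by apply: (tau_disj (t := [set v])); rewrite ?F_facet // inE t0 sub0set sub1set.
have vC : v \in C by case/facetP: s0F => /indepP[/subsetP s0C _] _; apply: s0C.
move=> vU; have : \bigcup_p singles p \proper C by apply/properP; split=> //; exists v.
by move/proper_card; rewrite cC -/U; lia.
Qed.

End Partition.

Lemma cycle_not_partitionable : n <> 1 -> ~ partitionable K.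
Proof.
move=> n1 [tau [tau_sub cover disj]].
have tau_cover t : t \in K -> exists2 s, s \in facets K & t \in interval (tau s) s.
  by rewrite {1}cover => /bigcupP[s]; exists s.
have tau_disj s s' t : s \in facets K -> s' \in facets K ->
  t \in interval (tau s) s -> t \in interval (tau s') s' -> s = s'.
  move=> sF s'F ts ts'; apply/eqP; apply: contraT => ne.
  by have /pred0P/(_ t) := disj _ _ sF s'F ne; rewrite /= ts ts'.
have [No|Ne] := boolP (odd N); last exact: (even_not_partition tau_sub tau_cover tau_disj).
(* An odd N other than 5 is at least 7. *)
apply: (odd_not_partition tau_sub tau_cover tau_disj No); lia.
Qed.

(** * Cycles are not sequentially Cohen-Macaulay *)

Section Homology.
Local Open Scope ring_scope.

Let top := pure_part ((N./2)%:Z - 1) K.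

Lemma topP t : reflect (exists p, t \subset F p) (t \in top).
Proof.
apply: (iffP (pure_partP _ _ _)) => [[s [sK si ts]]|[p tp]].
  have [_ [|p sE]] := max_indep sK; first by rewrite /fdim in si; lia.
  by exists p; rewrite -sE.
by exists (F p); rewrite F_indep /fdim card_F.
Qed.

(** The condition at the empty face, whose link is [top] itself. *)
Lemma scm_top k : sequentially_cohen_macaulay K -> k <> (N./2)%:Z - 1 ->
  reduced_homology_vanishes top k.
Proof.
move=> scm ki; have h0 : set0 \in top by apply/topP; exists 0; apply: sub0set.
have /cohen_macaulay_pure_part/(_ _ k h0) := scm ((N./2)%:Z - 1).
rewrite cards0 subr0 => /(_ ki); rewrite (_ : link _ _ = top) //.
apply/setP=> s; rewrite linkE; last exact: simplicial_pure_part.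
by rewrite setU0 -setI_eq0 setI0 eqxx.
Qed.

Lemma sub_F_imset t p : t \subset F p -> forall v, v \in t -> exists2 x, v = f x & odd (x - p)%R.
Proof. by move=> tF v /(subsetP tF)/imsetP[x]; rewrite inE => xo ->; exists x. Qed.

(** For N even parity is well defined modulo N and [top] is disconnected: the indicator [phi] of the
    vertices of [F 0] is constant on each [F p] but separates f 1 from f 0. *)
Lemma even_not_scm : ~~ odd N -> ~ sequentially_cohen_macaulay K.
Proof.
move=> Ne scm; have oB x q : odd (x - q)%R = odd x (+) odd q.
  have hx := ltn_ord x; have hq := ltn_ord q.
  rewrite /= modnDmr; have [qx|xq] := leqP q x.
    by rewrite addnBA ?(ltnW hq) // addnC -addnBA // modnDl modn_small; lia.
  by rewrite modn_small; lia.
pose phi t : int := (t :&: F 0 != set0)%:R.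
have phi1 x : phi [set f x] = (odd x)%:R.
  rewrite /phi setI_eq0 disjoints1 negbK mem_F oB; by case: odd.
have van : reduced_homology_vanishes top 0 by apply: scm_top => //; lia.
have loc s : s \in top -> fdim s = 0 + 1 ->
    exists g, forall v, v \in s -> phi (s :\ v) = coboundary g (s :\ v).
  (* On the vertices of [F p] the value of [phi] is ~~ odd p, the coboundary of a constant placed on
     the empty face. *)
  move=> /topP[p sp] s1; exists (fun=> (~~ odd p)%:R) => v vs.
  have : #|s :\ v| == 1%N by have := cardsD1 v s; rewrite vs; rewrite /fdim in s1; lia.
  case/cards1P=> u su; have : u \in s :\ v by rewrite su set11.
  case/setD1P=> _ /(sub_F_imset sp)[x ux]; rewrite oB => xo.
  rewrite su ux phi1 /coboundary big_set1 setDv sgn0 mul1r.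
  by move: xo; case: odd; case: odd.
have edge x : [set f x] \in top by apply/topP; exists (x - 1); rewrite sub1set mem_F opprB addrC subrK.
have pz : \sum_t phi t * (single [set f 1] - single [set f 0]) t = 1.
  under eq_bigr do rewrite ffunE [X in _ * (_ + X)]ffunE mulrBr.
  by rewrite sumrB !pair_single !phi1.
suff : \sum_t phi t * (single [set f 1] - single [set f 0]) t = 0 by rewrite pz.
apply: locally_coboundary_kills loc van _ _; last by rewrite boundaryD boundaryN !boundary_point subrr.
have chain1 x : chain top 0 (single [set f x]).
  move=> s; rewrite ffunE; have [-> _|_] := eqVneq s [set f x]; last by rewrite eqxx.
  by rewrite edge /fdim cards1.
by apply: chainD => //; apply: chainN.
Qed.

Section Odd.
Hypothesis Nodd : odd N.

Definition idx v : 'I_N := odflt 0 [pick x | f x == v].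

Lemma idxK : cancel f idx.
Proof. 
by move=> x; rewrite /idx; case: pickP => [y /eqP/f_inj|/(_ x)]; rewrite ?eqxx.
Qed.

(** Only the values at singletons matter: they lift the positions in [F p] to integers. *)
Definition offset p t : int := \sum_(v in t) (nat_of_ord (idx v - p)%R)%:Z.

Lemma offset1 p x : offset p [set f x] = (nat_of_ord (x - p)%R)%:Z.
Proof. by rewrite /offset big_set1 idxK. Qed.

(* The difference of two odd residues depends on its class modulo N only,
   because N is odd and the difference is even and less than N. *)
Lemma odd_residue_diff (x y : 'I_N) : odd x -> odd y ->
  x%:Z - y%:Z = if odd (x - y)%R then (nat_of_ord (x - y)%R)%:Z - N%:Z else (nat_of_ord (x - y)%R)%:Z.
Proof.
move=> xo yo; have hx := ltn_ord x; have hy := ltn_ord y.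
have : nat_of_ord (x - y)%R = (if (y <= x)%N then (x - y)%N else (x + N - y)%N).
  rewrite /= modnDmr addnBA; last exact: ltnW.
  case: leqP => h; last by rewrite modn_small //; lia.
  by rewrite addnC -addnBA // modnDl modn_small //; lia.
by case: leqP => h ->; case: ifP; lia.
Qed.

(** The right-hand side does not depend on p, so the local coboundaries agree on common edges. *)
Lemma coboundary_offset p x y : x != y ->
  f x \in F p -> f y \in F p ->
  coboundary (offset p) [set f x; f y] = sgn (f x) [set f y] *
     (if odd (y - x)%R then (nat_of_ord (y - x)%R)%:Z - N%:Z else (nat_of_ord (y - x)%R)%:Z).
Proof.
move=> xy; rewrite !mem_F => xo yo.
rewrite coboundary_set2 ?(inj_eq f_inj) // !offset1 odd_residue_diff //.
by rewrite (_ : y - p - (x - p) = y - x) //; ring.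
Qed.

(* The offsets agree up to a constant on [F p :&: F q], so that they define a
   1-cocycle, which is not a coboundary globally. *)
Definition winding t : int :=
  if [pick p | t \subset F p] is Some p then coboundary (offset p) t else 0.

Lemma windingE p t : t \subset F p -> #|t| = 2%N -> winding t = coboundary (offset p) t.
Proof.
move=> tp /eqP/cards2P[u [v [uv tE]]].
rewrite /winding; case: pickP => [q tq|/(_ p)]; last by rewrite tp.
move: tp tq; rewrite tE !subUset !sub1set => /andP[up vp] /andP[uq vq].
have [x _ ux] := imsetP up; have [y _ vy] := imsetP vp.
rewrite {u}ux {v}vy in uv tE up vp uq vq *; rewrite (inj_eq f_inj) in uv.
by rewrite !coboundary_offset.
Qed.

Lemma edge_top x : [set f x; f (x + 1 + 1)] \subset F (x - 1).
Proof.
rewrite subUset !sub1set !mem_F (_ : x - (x - 1) = 1); last by ring.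
rewrite (_ : x + 1 + 1 - (x - 1) = 1 + 1 + 1); last by ring.
by rewrite !val_succ.
Qed.

(** The cycle [z] is the sum of the arcs from f x to f (x + 2). Each arc has winding 2, so the total
    is 2N, whereas a boundary would give 0. *)
Lemma odd_not_scm : (2 < N./2)%N -> ~ sequentially_cohen_macaulay K.
Proof.
move=> N3 scm.
have van : reduced_homology_vanishes top 1 by apply: scm_top => //; lia.
have loc s : s \in top -> fdim s = 1 + 1 ->
    exists g, forall v, v \in s -> winding (s :\ v) = coboundary g (s :\ v).
  move=> /topP[p sp] s2; exists (offset p) => v vs; apply: windingE.
    exact: subset_trans (subD1set _ _) sp.
  by have := cardsD1 v s; rewrite vs; rewrite /fdim in s2; lia.
have xne x : x != x + 1 + 1.
  rewrite -subr_eq0 (_ : x - (x + 1 + 1) = - (1 + 1)); last by ring.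
  by rewrite oppr_eq0 two_neq0.
have card_edge x : #|[set f x; f (x + 1 + 1)]| = 2%N by rewrite cards2 (inj_eq f_inj) xne.
pose z : {ffun {set V} -> int} := \sum_x arc (f x) (f (x + 1 + 1)).
have zE t : z t = \sum_x arc (f x) (f (x + 1 + 1)) t by rewrite /z sum_ffunE.
have z0 : boundary z = 0.
  have -> : boundary z = \sum_x (single [set f (x + 1 + 1)] - single [set f x]).
    rewrite /z (big_morph _ (@boundaryD V) (@boundary0 V)).
    by apply: eq_bigr => x _; rewrite boundary_arc // (inj_eq f_inj).
  rewrite sumrB [X in _ - X](reindex_inj (addIr (1 + 1))) /=.
  by under [X in _ - X]eq_bigr do rewrite addrA; rewrite subrr.
have hz : chain top 1 z.
  move=> s zs; have [x xs] : exists x, s = [set f x; f (x + 1 + 1)].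
    have [/existsP[x /eqP sx]|no] := boolP [exists x, s == [set f x; f (x + 1 + 1)]].
      by exists x.
    case/negP: zs; rewrite zE big1 // => x _; rewrite 2!ffunE.
    by case: eqP => [sx|]; [case/negP: no; apply/existsP; exists x; apply/eqP|rewrite mulr0].
  by rewrite xs /fdim card_edge; split=> //; apply/topP; exists (x - 1); apply: edge_top.
have := locally_coboundary_kills loc van hz z0.
under eq_bigr do rewrite zE mulr_sumr.
rewrite exchange_big /= (eq_bigr (fun=> 2)) => [|x _].
  by rewrite sumr_const card_ord -mulr_natr; lia.
have -> : \sum_t winding t * arc (f x) (f (x + 1 + 1)) t =
    sgn (f x) [set f (x + 1 + 1)] * winding [set f x; f (x + 1 + 1)].
  rewrite -(pair_single winding) mulr_sumr; apply: eq_bigr => t _; rewrite [arc _ _ _]ffunE; ring.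
have eF := edge_top x; rewrite (windingE eF) //.
move: eF; rewrite subUset !sub1set => /andP[xF yF].
rewrite coboundary_offset // mulrA sgn2 mul1r (_ : x + 1 + 1 - x = 1 + 1); last by ring.
by rewrite !val_succ.
Qed.

End Odd.
Lemma cycle_not_scm : n <> 1%N -> ~ sequentially_cohen_macaulay K.
Proof.
by move=> n1; have [No|] := boolP (odd N); [apply: odd_not_scm; lia|apply: even_not_scm].
Qed.

End Homology.
End Cycle.

(** * Obstructions *)

Section Final.
Variable V : finType.
Implicit Types (G : {set {set V}}) (s t W C : {set V}) (x y : V).

(** A facet of the intersection containing t has codimension one in facet j, so it is a ridge, and
    it lies in an earlier facet. *)
Lemma shelling_ridge G (F : seq {set V}) i j t : shelling G F -> i < j < size F ->
  t \subset nth set0 F i -> t \subset nth set0 F j ->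
  exists x l, [/\ l < j, x \in nth set0 F j, t \subset nth set0 F j :\ x &
                  nth set0 F j :\ x \subset nth set0 F l].
Proof.
case=> _ _ shF /andP[ij jF] ti tj.
have [|puK dK] := shF j; first by rewrite jF (leq_trans _ ij).
have tK : t \in (\bigcup_(i < j) powerset (nth set0 F i)) :&: powerset (nth set0 F j).
  rewrite !inE tj andbT; apply/bigcupP; exists (Ordinal ij) => //; by rewrite inE.
have [r rF tr] := facet_above tK; have rj := puK r rF; rewrite dK in rj.
have /facetP[/setIP[/bigcupP[l _]]] := rF; rewrite !inE => rl rFj _.
have rcard : #|r| < #|nth set0 F j| by rewrite /fdim in rj; lia.
have /properP[_ [x xF xr]] : r \proper nth set0 F j by rewrite properEcard rFj.
have rE : r = nth set0 F j :\ x.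
  apply/eqP; rewrite eqEcard subsetD1 rFj xr /=.
  by have := cardsD1 x (nth set0 F j); rewrite xF /fdim in rj *; lia.
by exists x, l; rewrite -rE.
Qed.

(** The lower end [tau s] is the restriction set of the shelling, the vertices whose removal leaves
    a ridge covered earlier; a face then belongs to the interval of the first facet containing
    it. *)
Lemma shellable_partitionable G : simplicial_complex G -> shellable G -> partitionable G.
Proof.
move=> hG [F shF]; have [uF eF _] := shF.
pose tau s := [set x in s | [exists l : 'I_(index s F), s :\ x \subset nth set0 F l]].
have tauP i x : i < size F -> x \in tau (nth set0 F i) ->
    exists2 l, l < i & nth set0 F i :\ x \subset nth set0 F l.
  by move=> iF; rewrite inE index_uniq // => /andP[_ /existsP[l]]; exists l.
have tauI i l x : i < size F -> x \in nth set0 F i -> l < i ->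
    nth set0 F i :\ x \subset nth set0 F l -> x \in tau (nth set0 F i).
  move=> iF xF li sl; rewrite inE xF /=; apply/existsP; rewrite index_uniq //.
  by exists (Ordinal li).
(* A face of an earlier facet i inside facet j misses some vertex of the restriction set of facet
   j. *)
have no_common i j t : i < j < size F -> t \subset nth set0 F i ->
    t \notin interval (tau (nth set0 F j)) (nth set0 F j).
  move=> ij ti; rewrite inE; apply/negP=> /andP[tt tj].
  have [x [l [lj xF tx xl]]] := shelling_ridge shF ij ti tj.
  have /andP[_ jF] := ij; have := subsetP tx x (subsetP tt x (tauI j l x jF xF lj xl)).
  by rewrite !inE eqxx.
exists tau; split=> [s _||s s' sF s'F ne].
- by apply/subsetP=> x; rewrite inE => /andP[].
- apply/setP=> t; apply/idP/bigcupP => [tG|[s sF]]; last first.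
    by rewrite inE => /andP[_ ts]; case/facetP: sF => sG _; apply: hG ts.
  have exP : exists i, (i < size F) && (t \subset nth set0 F i).
    have [s sF ts] := facet_above tG; rewrite -eF in sF.
    by exists (index s F); rewrite index_mem sF nth_index.
  have [i /andP[iF ti] mini] := ex_minnP exP.
  exists (nth set0 F i); first by rewrite -eF mem_nth.
  rewrite inE ti andbT; apply/subsetP=> x xt; have [l li xl] := tauP i x iF xt.
  apply: contraT => xnt; have := mini l; rewrite (ltn_trans li iF) leqNgt li /=.
  by apply; apply: subset_trans xl; rewrite subsetD1 ti.
rewrite -eF in sF; rewrite -eF in s'F.
wlog lt : s s' sF s'F ne / index s F < index s' F.
  move=> H; have [lt|gt|E] := ltngtP (index s F) (index s' F); first exact: H.
    by rewrite disjoint_sym; apply: H => //; rewrite eq_sym.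
  by case/eqP: ne; rewrite -(nth_index set0 sF) E nth_index.
apply: disjointI => t; rewrite inE => /andP[_ ts].
have := @no_common (index s F) (index s' F) t; rewrite index_mem s'F lt !nth_index //.
by move=> /(_ isT ts)/negP.
Qed.

(** * Flag complexes as independence complexes, and their obstructions *)

Definition nonadjacent G : rel V := fun x y => (x != y) && ([set x; y] \notin G).

(** A subset of [W] that is not a face contains a minimal non-face, which is a pair of nonadjacent
    vertices by flagness. *)
Lemma restrict_flag G W : simplicial_complex G -> flag G -> W \subset vertices G ->
  restrict G W = indep (nonadjacent G) W.
Proof.
move=> hG hflag WV; apply/setP=> s; rewrite inE; apply/andP/indepP => [[sG sW]|[sW si]].
  split=> // x y xs ys; rewrite negb_and negbK; apply/orP; right; rewrite negbK.
  by apply: hG sG _; rewrite subUset !sub1set xs.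
split=> //; apply: contraT => sG.
have [|t tmin ts] := @minset_exists _ (fun t => (t \subset vertices G) && (t \notin G)) s.
  by rewrite sG (subset_trans sW).
have /eqP/cards2P[x [y [xy tE]]] := hflag t tmin.
have /minsetP[/andP[_ tG] _] := tmin.
have := si x y; rewrite /nonadjacent xy -tE tG /=; apply; apply: (subsetP ts); by rewrite tE !inE eqxx ?orbT.
Qed.

Lemma restrict_vertices G : simplicial_complex G -> restrict G (vertices G) = G.
Proof.
move=> hG; apply/setP=> s; rewrite inE; case sG: (s \in G) => //=.
by apply/subsetP=> x xs; rewrite inE; apply: hG sG _; rewrite sub1set.
Qed.

(** The right-hand side is free of [P], so any two properties satisfying the two premises have the
    same obstructions. *)
Lemma obstruction_flag (P : {set {set V}} -> Prop) G : simplicial_complex G -> flag G ->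
  (forall W, good (nonadjacent G) W -> P (indep (nonadjacent G) W)) ->
  (forall C, bad_cycle (nonadjacent G) C -> ~ P (indep (nonadjacent G) C)) ->
  obstruction P G <->
  ~ good (nonadjacent G) (vertices G) /\
  forall W, W \proper vertices G -> good (nonadjacent G) W.
Proof.
move=> hG hflag goodP badP.
have rE W : W \subset vertices G -> restrict G W = indep (nonadjacent G) W by exact: restrict_flag.
have PG : P G <-> P (indep (nonadjacent G) (vertices G)) by rewrite -rE // restrict_vertices.
split=> [[nP PW]|[ngood goodW]]; split.
- by move/goodP/PG.
- move=> W WV C CW /badP; apply; have CV := sub_proper_trans CW WV.
  by rewrite -rE ?proper_sub //; apply: PW.
- move=> /PG PV; apply: ngood => C CV badC.
  have [E|CV'] := eqVproper CV; first by apply: (badP _ badC); rewrite E.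
  exact: (goodW _ CV' C).
- by move=> W WV; rewrite rE ?proper_sub //; apply/goodP/goodW.
Qed.

End Final.

Theorem theorem3p13 (V : finType) (G : {set {set V}})
    (hG : simplicial_complex G) (hflag : flag G) :
  (obstruction (@shellable V) G <-> obstruction (@partitionable V) G) /\
  (obstruction (@partitionable V) G <->
     obstruction (@sequentially_cohen_macaulay V) G).
Proof.
set e := nonadjacent G.
have e_sym : symmetric e by move=> x y; rewrite /e /nonadjacent eq_sym setUC.
have e_irr : irreflexive e by move=> x; rewrite /e /nonadjacent eqxx.
have vd W : good e W -> vertex_decomposable (indep e W).
  exact: good_vertex_decomposable.
have bad_part C : bad_cycle e C -> ~ partitionable (indep e C).
  by case=> n [f [n1 f_inj -> eE]]; apply: cycle_not_partitionable.
have bad_scm C : bad_cycle e C -> ~ sequentially_cohen_macaulay (indep e C).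
  by case=> n [f [n1 f_inj -> eE]]; apply: cycle_not_scm.
have bad_shell C : bad_cycle e C -> ~ shellable (indep e C).
  by move=> /bad_part np /shellable_partitionable -/(_ (@simplicial_indep _ _ _)).
have obs_shell := obstruction_flag hG hflag (fun W gW => vd_shellable (vd W gW)) bad_shell.
have obs_part := obstruction_flag hG hflag (fun W gW => vd_partitionable (vd W gW)) bad_part.
have obs_scm := obstruction_flag hG hflag (fun W gW => vd_scm (vd W gW)) bad_scm.
by split; apply: iff_trans; [exact: obs_shell|exact: iff_sym|exact: obs_part|exact: iff_sym].
Qed.
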